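(* Let $A$ be an algebra and $X$ be a polygraphic resolution of $A$. If $Y$ is an indexed subset of $X$, and $\varphi$ is a collapsing scheme of $X$ onto $Y$, then $Y$, equipped with the structure of $\infty$-polygraph induced by $\varphi$ (given by the maps $\overline{s},\overline{t}$ defined in the context), is a polygraphic resolution of $A$.
   Context: Fix a field $\mathbb{K}$; algebras are unital associative over $\mathbb{K}$. An $\infty$-algebra $A$ is a strict globular $\infty$-category internal to algebras: algebras $A_n$ ($n\ge0$, elements are $n$-cells), algebra morphisms $s,t:A_{n+1}\to A_n$ and $i:A_n\to A_{n+1}$ ($i(a)=1_a$, often written $a$) with $ss=st$, $ts=tt$, $si=ti=\mathrm{id}$, and compositions $a\star_k b$ of $n$-cells with $t_k(a)=s_k(b)$, $0\le k<n$ ($s_k,t_k$: iterated source and target in dimension $k$), which are algebra morphisms and satisfy the usual axioms of strict $\infty$-categories. Necessarily $a\star_k b=a-t_k(a)+b$. An $n$-algebra is the same with cells of dimension at most $n$. Morphisms of $\infty$-algebras are sequences of algebra morphisms commuting with $s,t,i$ (hence with all compositions). Two $n$-cells are parallel if $n=0$ or they have the same source and the same target. The boundary of an $n$-cell $a$, $n\ge1$, is $\partial(a)=s(a)-t(a)$. A cellular extension of an $n$-algebra $A$ is a set $Z$ with maps $s,t:Z\to A_n$ such that $s(z),t(z)$ are parallel. The free $(n+1)$-algebra $A[Z]$ extends $A$ with $(n+1)$-cells, the elements of the quotient of the $A_0$-bimodule $(A_0\otimes\mathbb{K}Z\otimes A_0)\oplus A_n$ by the sub-bimodule generated by the elements $(as_0(b)+t_0(a)b-t_0(a)s_0(b))-(s_0(a)b+at_0(b)-s_0(a)t_0(b))$,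 $a,b\in A_0\otimes\mathbb{K}Z\otimes A_0$; here $s(azb)=a\,s(z)\,b$, $t(azb)=a\,t(z)\,b$, $c\in A_n$ is the identity $1_c$, and the product is $ab=as_0(b)+t_0(a)b-t_0(a)s_0(b)$. $Z$ is acyclic if for all parallel $n$-cells $a,b$ of $A$ there is an $(n+1)$-cell $a\to b$ in $A[Z]$. An $\infty$-polygraph $X=\langle X_0|X_1|\cdots\rangle$ is a set $X_0$ and, for each $n\ge0$, a cellular extension $X_{n+1}$ of the free $n$-algebra $\mathcal{A}(X_0)[X_1]\cdots[X_n]$, with $\mathcal{A}(X_0)$ the free algebra on $X_0$. The resulting free $\infty$-algebra is $\mathcal{A}(X)$; elements of $X_n$ are the $n$-cells of $X$. The algebra presented by $X$ is $\overline{X}=\mathcal{A}(X_0)/(s(\alpha)-t(\alpha),\,\alpha\in X_1)$. $X$ is a polygraphic resolution of an algebra $A$ if $\overline{X}\simeq A$ and, for every $n\ge1$, the cellular extension $X_{n+1}$ is acyclic. Monomials are the elements of the free monoid $X_0^*$ (a linear basis of $\mathcal{A}(X_0)$); for $n\ge1$ an $n$-monomial is an $n$-cell $u\alpha v$ of $\mathcal{A}(X)$ with $\alpha\in X_n$ and $u,v$ monomials. Every $n$-cell $a$, $n\ge1$, is a linear combination of pairwise distinct $n$-monomials plus an identity; the size of $a$ is the minimal number of $n$-monomials needed, and $\mathrm{cell}(a)\subseteq X_n$ is the set of $n$-cells of $X$ appearing in the corresponding $n$-monomials. (For a $0$-cell, $\mathrm{cell}(a)\subseteq X_0$ is the set of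 generators appearing in the monomials of $a$ with nonzero coefficient.) Indexed subset: $Y=(Y_n)_{n\ge0}$ with $Y_n\subseteq X_n$. A collapsing scheme of $X$ onto $Y$ is an injective partial map $\varphi$, $x\mapsto\varphi_x$, sending $n$-cells of $X$ to $(n+1)$-cells of $X$, such that: (i) in each dimension $X$ is the disjoint union of $\mathrm{im}(\varphi)$, $Y$ and $\mathrm{dom}(\varphi)$; (ii) for each $n$-cell $x\in\mathrm{dom}(\varphi)$, $\partial(\varphi_x)=\lambda x+a$, with $\lambda$ a nonzero scalar and $a$ an $n$-cell of $\mathcal{A}(X)$ with $x\notin\mathrm{cell}(a)$; (iii) putting $x\trianglerighteq_\varphi y$ for all $x\in\mathrm{dom}(\varphi)$ and $y\in\mathrm{cell}(\partial(\varphi_x))$ defines (generates) a wellfounded order on the cells of $X$. In (ii) put $\widetilde{x}=-\frac1\lambda a$. The following formulas define, by mutual induction, an $\infty$-polygraph structure on $Y$, with source and target maps $\overline{s},\overline{t}$, and a morphism of $\infty$-algebras $\pi:\mathcal{A}(X)\to\mathcal{A}(Y)$: for every $n\ge1$ and $n$-cell $x$ of $Y$, $\overline{s}(x)=\pi(s(x))$ and $\overline{t}(x)=\pi(t(x))$; and for every $n\ge0$ and $n$-cell $x$ of $X$, $\pi(x)=x$ if $x\in Y$, $\pi(x)=\pi(\widetilde{x})$ if $x\in\mathrm{dom}(\varphi)$, and $\pi(x)=1_{\pi(s(x))}$ if $x\in\mathrm{im}(\varphi)$.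
   Formalization: In A[Z], the exchange relations are imposed for all a,b in the whole bimodule, identities included (otherwise A[Z] is not an (n+1)-algebra); in (iii), cell(∂(φ_x)) is read as {x} together with cell(a), for some minimal decomposition of a, since in dimension 1 the literal reading fails. *)

(* Defs.v *)
Set Warnings "-notation-incompatible-prefix,-notation-overridden,-deprecated,-ambiguous-paths,-redundant-canonical-projection".
From HB Require Import structures.
From mathcomp Require Import all_boot all_algebra generic_quotient ring_quotient.
From mathcomp Require Import finmap monalg.
From mathcomp Require Import boolp.
From Stdlib Require Import Relation_Operators.

Set Implicit Arguments.
Unset Strict Implicit.
Unset Printing Implicit Defensive.

Import GRing.Theory.
Local Open Scope ring_scope.
Local Open Scope quotient_scope.

(** * Free modules and free algebras *)

Section FreeModule.
Variables (K : fieldType) (T : choiceType).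

Definition freemod := {malg K[T]}.
HB.instance Definition _ := GRing.Lmodule.on freemod.

Definition fgen (x : T) : freemod := << x >>.

Variable W : lmodType K.

(* Linear extension of a map defined on the basis T. *)
Definition flin (f : T -> W) (g : freemod) : W :=
  \sum_(k <- msupp g) g@_k *: f k.

Lemma flinEw f (d : {fset T}) g : (msupp g `<=` d)%fset ->
  flin f g = \sum_(k <- d) g@_k *: f k.
Proof.
move=> le; rewrite /flin (big_fset_incl _ le) // => x xd /mcoeff_outdom ->.
by rewrite scale0r.
Qed.

Lemma flin_is_linear f : linear (flin f).
Proof.
move=> k g1 g2; pose d := (msupp (k *: g1 + g2) `|` msupp g1 `|` msupp g2)%fset.
rewrite (@flinEw f d (k *: g1 + g2)) ?(@flinEw f d g1) ?(@flinEw f d g2);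
  try by apply/fsubsetP => x xg; rewrite !in_fsetE xg ?orbT.
rewrite scaler_sumr -big_split /=; apply: eq_bigr => x _.
by rewrite mcoeffD mcoeffZ scalerDl scalerA.
Qed.

HB.instance Definition _ f :=
  GRing.isLinear.Build K freemod W _ (flin f) (flin_is_linear f).

Lemma flinU f x : flin f (fgen x) = f x.
Proof. by rewrite (flinEw _ msuppU_le) big_seq_fset1 mcoeffUU scale1r. Qed.

Lemma freemodE (g : freemod) : g = \sum_(x <- msupp g) g@_x *: fgen x.
Proof.
rewrite {1}[g]monalgE; apply: eq_bigr => x _; apply/malgP => y.
by rewrite mcoeffZ !mcoeffU; case: eqP; rewrite ?mulr1 ?mulr0.
Qed.

Lemma flin_ext (f1 f2 : {linear freemod -> W}) :
  (forall x, f1 (fgen x) = f2 (fgen x)) -> f1 =1 f2.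
Proof.
by move=> E g; rewrite [g]freemodE !linear_sum; apply: eq_bigr => x _;
  rewrite !linearZ E.
Qed.

End FreeModule.

Section FreeAlgebra.
Variables (K : fieldType) (X : choiceType).

Definition freealg := {malg K[{fmonom X}]}.

HB.instance Definition _ := GRing.Lalgebra.on freealg.

Fact freealg_scaleAr (k : K) (x y : freealg) : k *: (x * y) = x * (k *: y).
Proof.
rewrite malgME (malgMEw (fsubset_refl _) (msuppZ_le k y)) scaler_sumr.
apply: eq_bigr => i _; rewrite scaler_sumr; apply: eq_bigr => j _.
by rewrite mcoeffZ; apply/malgP => m; rewrite mcoeffZ !mcoeffU mulrnAr mulrCA.
Qed.

HB.instance Definition _ :=
  GRing.Lalgebra_isAlgebra.Build K freealg freealg_scaleAr.
End FreeAlgebra.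

(** * n-algebras and cellular extensions *)

(* The part of an n-algebra that determines its cellular extensions: the       *)
(* algebra of n-cells, over the algebra B of 0-cells, with the 0-source, the   *)
(* 0-target, the iterated identity from dimension 0 and parallelism.  [nmulr]  *)
(* and [nmull] hold in every n-algebra: they are the multiplicativity of the   *)
(* composition of dimension 0 at the pairs (a, 1), (1, b) and (1, b), (a, 1).  *)
(* All dimensions are put together in [ooalg] and [freeoo] below.              *)
Record nalg (K : fieldType) (B : algType K) (n : nat) := NAlg {
  ncell :> algType K;
  nsrc0 : {lrmorphism ncell -> B};
  ntgt0 : {lrmorphism ncell -> B};
  nid0 : {lrmorphism B -> ncell};
  npar : ncell -> ncell -> Prop;
  nsrc0K : cancel nid0 nsrc0;
  ntgt0K : cancel nid0 ntgt0;
  nmulr : forall a b : ncell, a * b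
    = a * nid0 (nsrc0 b) + nid0 (ntgt0 a) * b - nid0 (ntgt0 a * nsrc0 b);
  nmull : forall a b : ncell, a * b
    = nid0 (nsrc0 a) * b + a * nid0 (ntgt0 b) - nid0 (nsrc0 a * ntgt0 b);
  npar_refl : forall a, npar a a;
  npar_lin : forall (k : K) a b c d,
    npar a b -> npar c d -> npar (k *: a + c) (k *: b + d);
  npar_mul : forall a b c d, npar a b -> npar c d -> npar (a * c) (b * d);
  ndim0 : n = 0%N -> forall a, nid0 (nsrc0 a) = a /\ nid0 (ntgt0 a) = a;
  ndimS : (0 < n)%N -> forall a b, npar a b ->
    nsrc0 a = nsrc0 b /\ ntgt0 a = ntgt0 b
}.

Record cellext (K : fieldType) (B : algType K) (n : nat) (A : nalg B n)
    (Z : choiceType) := CellExt {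
  cesrc : Z -> A;
  cetgt : Z -> A;
  cepar : forall z, npar (cesrc z) (cetgt z)
}.

Section NalgTheory.
Variables (K : fieldType) (B : algType K) (n : nat) (A : nalg B n).
Local Notation i0 := (nid0 A).
Local Notation s0 := (nsrc0 A).
Local Notation t0 := (ntgt0 A).
Implicit Types a b c d : A.

Lemma nparD a b c d : npar a b -> npar c d -> npar (a + c) (b + d).
Proof. by move=> ab cd; rewrite -[a]scale1r -[b]scale1r; apply: npar_lin. Qed.

Lemma nparZ (k : K) a b : npar a b -> npar (k *: a) (k *: b).
Proof.
by move=> ab; rewrite -[k *: a]addr0 -[k *: b]addr0; apply: npar_lin => //;
  apply: npar_refl.
Qed.

Lemma swap_tl a b c : npar a b ->
  i0 (t0 a) * c - i0 (t0 a * s0 c) = i0 (t0 b) * c - i0 (t0 b * s0 c).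
Proof.
have [/(@ndim0 _ _ _ A) n0 _|n_gt0 /(ndimS n_gt0)[_ ->] //] := posnP n.
by have [e1 e2] := n0 c; rewrite !rmorphM /= ?e1 ?e2 !subrr.
Qed.

Lemma swap_sr a b c : npar a b ->
  c * i0 (s0 a) - i0 (t0 c * s0 a) = c * i0 (s0 b) - i0 (t0 c * s0 b).
Proof.
have [/(@ndim0 _ _ _ A) n0 _|n_gt0 /(ndimS n_gt0)[-> _] //] := posnP n.
by have [e1 e2] := n0 c; rewrite !rmorphM /= ?e1 ?e2 !subrr.
Qed.

Lemma swap_sl a b c : npar a b ->
  i0 (s0 a) * c - i0 (s0 a * t0 c) = i0 (s0 b) * c - i0 (s0 b * t0 c).
Proof.
have [/(@ndim0 _ _ _ A) n0 _|n_gt0 /(ndimS n_gt0)[-> _] //] := posnP n.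
by have [e1 e2] := n0 c; rewrite !rmorphM /= ?e1 ?e2 !subrr.
Qed.

Lemma swap_tr a b c : npar a b ->
  c * i0 (t0 a) - i0 (s0 c * t0 a) = c * i0 (t0 b) - i0 (s0 c * t0 b).
Proof.
have [/(@ndim0 _ _ _ A) n0 _|n_gt0 /(ndimS n_gt0)[_ ->] //] := posnP n.
by have [e1 e2] := n0 c; rewrite !rmorphM /= ?e1 ?e2 !subrr.
Qed.

Lemma ncomp_mul0 a b c d x y : t0 a = x -> s0 b = x -> t0 c = y -> s0 d = y ->
  a * c - i0 x * i0 y + b * d = (a - i0 x + b) * (c - i0 y + d).
Proof.
move=> ta sb tc sd; set e := i0 x; set f := i0 y.
have ad : a * d = a * f + e * d - e * f.
  by rewrite nmulr ta sd (rmorphM i0).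
have bc : b * c = e * c + b * f - e * f.
  by rewrite nmull sb tc (rmorphM i0).
rewrite !mulrDl !mulrDr !mulNr !mulrN opprK ad bc !addrA.
rewrite [RHS](ACl (1*11*13*(2*3)*(4*8)*(5*7)*(6*9)*(10*12)))%AC /=.
by rewrite !addNr !subrr !addr0.
Qed.

Lemma ncomp_mulS a b e c d f :
  s0 a = s0 e -> t0 a = t0 e -> s0 b = s0 e -> t0 b = t0 e ->
  s0 c = s0 f -> t0 c = t0 f -> s0 d = s0 f -> t0 d = t0 f ->
  a * c - e * f + b * d = (a - e + b) * (c - f + d).
Proof.
move=> sa ta sb tb sc tc sd td.
have E u v : t0 u = t0 e -> s0 v = s0 f ->
    u * v = u * i0 (s0 f) + i0 (t0 e) * v - i0 (t0 e * s0 f).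
  by move=> <- <-; apply: nmulr.
rewrite (E a) // (E e) // (E b) // (E (_ + _)).
- rewrite !mulrDl !mulrDr !mulNr !mulrN !opprD opprK !addrA.
  rewrite [LHS](ACl (1*4*7*2*5*8*9*(3*6)))%AC /=.
  by rewrite addNr addr0.
- by rewrite linearD linearB /= ta tb subrr add0r.
- by rewrite linearD linearB /= sc sd subrr add0r.
Qed.
End NalgTheory.

Section FreeExtension.
Variables (K : fieldType) (B : algType K) (n : nat) (A : nalg B n).
Variables (Z : choiceType) (E : cellext A Z).

Local Notation i0 := (nid0 A).

(* Formal sums of symbols a z b, plus an n-cell; [extrel] below also makes the *)
(* symbols bilinear, so that its quotient is a quotient of                     *)
(* (B (x) KZ (x) B) (+) A.                                                     *)
Definition preext := (freemod K (B * Z * B)%type * A)%type.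
HB.instance Definition _ := GRing.Lmodule.on preext.

Definition sym (a : B) (z : Z) (b : B) : preext := (fgen K (a, z, b), 0).

Definition prelact (a : B) (x : preext) : preext :=
  (flin (fun w => fgen K (a * w.1.1, w.1.2, w.2)) x.1, i0 a * x.2).
Definition preract (b : B) (x : preext) : preext :=
  (flin (fun w => fgen K (w.1.1, w.1.2, w.2 * b)) x.1, x.2 * i0 b).
Definition preid (c : A) : preext := (0, c).
Definition presrc (x : preext) : A :=
  flin (fun w => i0 w.1.1 * cesrc E w.1.2 * i0 w.2) x.1 + x.2.
Definition pretgt (x : preext) : A :=
  flin (fun w => i0 w.1.1 * cetgt E w.1.2 * i0 w.2) x.1 + x.2.
Definition presrc0 x := nsrc0 A (presrc x).
Definition pretgt0 x := ntgt0 A (pretgt x).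

Definition premulr (x y : preext) : preext :=
  preract (presrc0 y) x + prelact (pretgt0 x) y
  - preid (i0 (pretgt0 x * presrc0 y)).
Definition premull (x y : preext) : preext :=
  prelact (presrc0 x) y + preract (pretgt0 y) x
  - preid (i0 (presrc0 x * pretgt0 y)).

(* The sub-bimodule to quotient by.  In [rel_exchange], x and y range over the *)
(* whole bimodule, identities included: if only sums of symbols were taken,    *)
(* then for n > 0 the interchange law would fail on the product of an element  *)
(* of Z with the identity of a lower-dimensional cell, and A[Z] would not be   *)
(* an (n+1)-algebra.  On two identities the relation is void by [nmull].       *)
Inductive extrel : preext -> Prop :=
| rel_linl k a a' z b :
    extrel (sym (k *: a + a') z b - (k *: sym a z b + sym a' z b))
| rel_linr k a z b b' :
    extrel (sym a z (k *: b + b') - (k *: sym a z b + sym a z b'))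
| rel_exchange x y : extrel (premulr x y - premull x y)
| rel_lin k x y : extrel x -> extrel y -> extrel (k *: x + y)
| rel_lact a x : extrel x -> extrel (prelact a x)
| rel_ract b x : extrel x -> extrel (preract b x).

Fact prelact_linear a : linear (prelact a).
Proof.
move=> k x y; rewrite /prelact linearP mulrDr -scalerAr.
by congr (_, _); rewrite /= linearP.
Qed.
HB.instance Definition _ a :=
  GRing.isLinear.Build K preext preext _ (prelact a) (prelact_linear a).

Fact preract_linear b : linear (preract b).
Proof.
move=> k x y; rewrite /preract linearP mulrDl -scalerAl.
by congr (_, _); rewrite /= linearP.
Qed.
HB.instance Definition _ b :=
  GRing.isLinear.Build K preext preext _ (preract b) (preract_linear b).

Fact preid_linear : linear preid.
Proof. by move=> k c d; congr (_, _); rewrite /= scaler0 addr0. Qed.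
HB.instance Definition _ := GRing.isLinear.Build K A preext _ preid preid_linear.

Fact presrc_linear : linear presrc.
Proof. by move=> k x y; rewrite /presrc /= linearP scalerDr addrACA. Qed.
HB.instance Definition _ :=
  GRing.isLinear.Build K preext A _ presrc presrc_linear.

Fact pretgt_linear : linear pretgt.
Proof. by move=> k x y; rewrite /pretgt /= linearP scalerDr addrACA. Qed.
HB.instance Definition _ :=
  GRing.isLinear.Build K preext A _ pretgt pretgt_linear.

Lemma preext_ext (W : lmodType K) (f g : {linear preext -> W}) :
  (forall a z b, f (sym a z b) = g (sym a z b)) ->
  (forall c, f (preid c) = g (preid c)) -> f =1 g.
Proof.
move=> Es Ei [x c].
have -> : (x, c) = (x, 0) + preid c by congr (_, _); rewrite ?addr0 ?add0r.
rewrite !linearD Ei; congr (_ + _).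
pose j (x : freemod K (B * Z * B)%type) : preext := (x, 0).
have jl : linear j by move=> k y y'; congr (_, _); rewrite /= scaler0 addr0.
pose F := GRing.isLinear.Build K _ preext _ j jl.
pose J : {linear freemod K (B * Z * B)%type -> preext} := HB.pack j F.
rewrite -[LHS]/((f \o J) x) -[RHS]/((g \o J) x).
by apply: flin_ext => -[[a z] b]; apply: Es.
Qed.

Lemma prelact_sym a a' z b : prelact a (sym a' z b) = sym (a * a') z b.
Proof. by rewrite /prelact flinU mulr0. Qed.
Lemma preract_sym b' a z b : preract b' (sym a z b) = sym a z (b * b').
Proof. by rewrite /preract flinU mul0r. Qed.
Lemma prelact_id a c : prelact a (preid c) = preid (i0 a * c).
Proof. by rewrite /prelact linear0. Qed.
Lemma preract_id b c : preract b (preid c) = preid (c * i0 b).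
Proof. by rewrite /preract linear0. Qed.
Lemma presrc_sym a z b : presrc (sym a z b) = i0 a * cesrc E z * i0 b.
Proof. by rewrite /presrc flinU addr0. Qed.
Lemma pretgt_sym a z b : pretgt (sym a z b) = i0 a * cetgt E z * i0 b.
Proof. by rewrite /pretgt flinU addr0. Qed.
Lemma presrc_id c : presrc (preid c) = c.
Proof. by rewrite /presrc linear0 add0r. Qed.
Lemma pretgt_id c : pretgt (preid c) = c.
Proof. by rewrite /pretgt linear0 add0r. Qed.

Lemma presrc_lact a x : presrc (prelact a x) = i0 a * presrc x.
Proof.
apply: (preext_ext (f := presrc \o prelact a) (g := i0 a \*o presrc)) => /=.
  by move=> a' z b; rewrite prelact_sym !presrc_sym rmorphM !mulrA.
by move=> c; rewrite prelact_id !presrc_id.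
Qed.

Lemma pretgt_lact a x : pretgt (prelact a x) = i0 a * pretgt x.
Proof.
apply: (preext_ext (f := pretgt \o prelact a) (g := i0 a \*o pretgt)) => /=.
  by move=> a' z b; rewrite prelact_sym !pretgt_sym rmorphM !mulrA.
by move=> c; rewrite prelact_id !pretgt_id.
Qed.

Lemma presrc_ract a x : presrc (preract a x) = presrc x * i0 a.
Proof.
apply: (preext_ext (f := presrc \o preract a) (g := i0 a \o* presrc)) => /=.
  by move=> a' z b; rewrite preract_sym !presrc_sym rmorphM !mulrA.
by move=> c; rewrite preract_id !presrc_id.
Qed.

Lemma pretgt_ract a x : pretgt (preract a x) = pretgt x * i0 a.
Proof.
apply: (preext_ext (f := pretgt \o preract a) (g := i0 a \o* pretgt)) => /=.
  by move=> a' z b; rewrite preract_sym !pretgt_sym rmorphM !mulrA.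
by move=> c; rewrite preract_id !pretgt_id.
Qed.

Lemma prepar x : npar (presrc x) (pretgt x).
Proof.
apply: nparD; last exact: npar_refl.
rewrite /flin; elim: (enum_fset _) => [|[[a z] b] r IHr].
  by rewrite !big_nil; apply: npar_refl.
rewrite !big_cons; apply: npar_lin IHr => /=.
by do ![apply: npar_mul; try exact: npar_refl]; apply: cepar.
Qed.



Lemma presrc_mulr x y : presrc (premulr x y) = presrc x * presrc y.
Proof.
rewrite /premulr /presrc0 /pretgt0 linearB linearD /= presrc_lact presrc_ract presrc_id.
by rewrite [RHS]nmulr -!addrA (swap_tl _ (prepar x)).
Qed.

Lemma pretgt_mulr x y : pretgt (premulr x y) = pretgt x * pretgt y.
Proof.
rewrite /premulr /presrc0 /pretgt0 linearB linearD /= pretgt_lact pretgt_ract pretgt_id.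
by rewrite [RHS]nmulr -!(addrAC _ (- _)) (swap_sr _ (prepar y)).
Qed.

Lemma presrc_mull x y : presrc (premull x y) = presrc x * presrc y.
Proof.
rewrite /premull /presrc0 /pretgt0 linearB linearD /= presrc_lact presrc_ract presrc_id.
by rewrite [RHS]nmull -!addrA (swap_tr _ (prepar y)).
Qed.

Lemma pretgt_mull x y : pretgt (premull x y) = pretgt x * pretgt y.
Proof.
rewrite /premull /presrc0 /pretgt0 linearB linearD /= pretgt_lact pretgt_ract pretgt_id.
by rewrite [RHS]nmull -!(addrAC _ (- _)) (swap_sl _ (prepar x)).
Qed.

Lemma presrcP k x y : presrc (k *: x + y) = k *: presrc x + presrc y.
Proof. exact: linearP. Qed.
Lemma pretgtP k x y : pretgt (k *: x + y) = k *: pretgt x + pretgt y.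
Proof. exact: linearP. Qed.
Lemma presrcB x y : presrc (x - y) = presrc x - presrc y.
Proof. exact: linearB. Qed.
Lemma pretgtB x y : pretgt (x - y) = pretgt x - pretgt y.
Proof. exact: linearB. Qed.

Lemma extrel_sound x : extrel x -> presrc x = 0 /\ pretgt x = 0.
Proof.
elim=> [k a a' z b|k a z b b'|{}x y|k {}x y _ [sx tx] _ [sy ty]|a {}x _ [sx tx]
  |b {}x _ [sx tx]].
- rewrite presrcB pretgtB (presrcP k (sym a z b)) (pretgtP k (sym a z b)).
  rewrite (presrc_sym (k *: a + a')) (presrc_sym a) (presrc_sym a').
  rewrite (pretgt_sym (k *: a + a')) (pretgt_sym a) (pretgt_sym a') (linearP i0).
  by rewrite !mulrDl -!scalerAl !subrr.
- rewrite presrcB pretgtB (presrcP k (sym a z b)) (pretgtP k (sym a z b)).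
  rewrite (presrc_sym _ _ (k *: b + b')) (presrc_sym _ _ b) (presrc_sym _ _ b').
  rewrite (pretgt_sym _ _ (k *: b + b')) (pretgt_sym _ _ b) (pretgt_sym _ _ b').
  rewrite (linearP i0).
  by rewrite !mulrDr -!scalerAr !subrr.
- by rewrite presrcB pretgtB presrc_mulr presrc_mull pretgt_mulr pretgt_mull !subrr.
- by rewrite presrcP pretgtP sx sy tx ty scaler0 addr0.
- by rewrite presrc_lact pretgt_lact sx tx mulr0.
- by rewrite presrc_ract pretgt_ract sx tx mul0r.
Qed.

Lemma extrel0 : extrel 0.
Proof.
have /(rel_lin (-1)) h := rel_exchange 0 0.
by have := h _ (rel_exchange 0 0); rewrite scaleN1r addNr.
Qed.
Lemma extrelD x y : extrel x -> extrel y -> extrel (x + y).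
Proof. by move=> /(rel_lin 1) h /h; rewrite scale1r. Qed.
Lemma extrelZ k x : extrel x -> extrel (k *: x).
Proof. by move=> /(rel_lin k) /(_ extrel0); rewrite addr0. Qed.
Lemma extrelN x : extrel x -> extrel (- x).
Proof. by move=> /(extrelZ (-1)); rewrite scaleN1r. Qed.

Definition extker : {pred preext} := fun x => `[< extrel x >].

Fact extker_zmod_closed : zmod_closed extker.
Proof.
split; first exact/asboolP/extrel0.
by move=> x y /asboolP rx /asboolP ry; apply/asboolP/extrelD/extrelN.
Qed.
HB.instance Definition _ :=
  GRing.isZmodClosed.Build preext extker extker_zmod_closed.

(* The algebra of (n+1)-cells of A[Z]. *)
Definition extcell := Quotient.quot extker.
HB.instance Definition _ := GRing.Zmodule.on extcell.

Definition extpi (x : preext) : extcell := \pi x.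

Lemma extpiP x y : extpi x = extpi y <-> extrel (x - y).
Proof.
have h : (extpi x == extpi y) = `[< extrel (x - y) >].
  by rewrite eqquotE Quotient.equivE.
by split=> [/eqP|r]; [rewrite h => /asboolP|apply/eqP; rewrite h; apply/asboolP].
Qed.

Lemma extpiK (q : extcell) : extpi (repr q) = q.
Proof. exact: reprK. Qed.

Lemma extpiD x y : extpi (x + y) = extpi x + extpi y.
Proof. by rewrite /extpi !piE. Qed.

Definition extscale (k : K) (q : extcell) : extcell := extpi (k *: repr q).

Lemma extpiZ k x : extpi (k *: x) = extscale k (extpi x).
Proof.
apply/extpiP; rewrite -scalerBr; apply/extrelZ/extpiP.
by rewrite extpiK.
Qed.

Fact extscaleA j k q : extscale j (extscale k q) = extscale (j * k) q.
Proof. by rewrite -[q]extpiK -!extpiZ scalerA. Qed.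
Fact extscale1 : left_id 1 extscale.
Proof. by move=> q; rewrite -[q]extpiK -!extpiZ scale1r. Qed.
Fact extscaleDr : right_distributive extscale +%R.
Proof.
by move=> k p q; rewrite -[p]extpiK -[q]extpiK -!(extpiD, extpiZ) scalerDr.
Qed.
Fact extscaleDl q : {morph extscale^~ q : j k / j + k}.
Proof. by move=> j k; rewrite -[q]extpiK -!extpiZ scalerDl extpiD. Qed.
HB.instance Definition _ := GRing.Zmodule_isLmodule.Build K extcell
  extscaleA extscale1 extscaleDr extscaleDl.

Fact extpi_linear : linear extpi.
Proof. by move=> k x y; rewrite extpiD extpiZ. Qed.
HB.instance Definition _ :=
  GRing.isLinear.Build K preext extcell _ extpi extpi_linear.

Definition lact a (q : extcell) : extcell := extpi (prelact a (repr q)).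
Definition ract b (q : extcell) : extcell := extpi (preract b (repr q)).
Definition extid (c : A) : extcell := extpi (preid c).
Definition extsrc (q : extcell) : A := presrc (repr q).
Definition exttgt (q : extcell) : A := pretgt (repr q).

Lemma lactE a x : lact a (extpi x) = extpi (prelact a x).
Proof.
by apply/extpiP; rewrite -linearB; apply/rel_lact/extpiP; rewrite extpiK.
Qed.
Lemma ractE b x : ract b (extpi x) = extpi (preract b x).
Proof.
by apply/extpiP; rewrite -linearB; apply/rel_ract/extpiP; rewrite extpiK.
Qed.
Lemma extsrcE x : extsrc (extpi x) = presrc x.
Proof.
apply/subr0_eq; rewrite -presrcB.
by apply: (proj1 (extrel_sound _)); apply/extpiP; rewrite extpiK.
Qed.
Lemma exttgtE x : exttgt (extpi x) = pretgt x.
Proof.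
apply/subr0_eq; rewrite -pretgtB.
by apply: (proj2 (extrel_sound _)); apply/extpiP; rewrite extpiK.
Qed.

Fact lact_linear a : linear (lact a).
Proof.
move=> k p q; rewrite -[p]extpiK -[q]extpiK -linearP !lactE.
by rewrite -linearP; congr extpi; rewrite linearP.
Qed.
HB.instance Definition _ a :=
  GRing.isLinear.Build K extcell extcell _ (lact a) (lact_linear a).
Fact ract_linear a : linear (ract a).
Proof.
move=> k p q; rewrite -[p]extpiK -[q]extpiK -linearP !ractE.
by rewrite -linearP; congr extpi; rewrite linearP.
Qed.
HB.instance Definition _ a :=
  GRing.isLinear.Build K extcell extcell _ (ract a) (ract_linear a).
Fact extid_linear : linear extid.
Proof. by move=> k p q; rewrite -linearP; congr extpi; rewrite linearP. Qed.
HB.instance Definition _ := GRing.isLinear.Build K A extcell _ extid extid_linear.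
Fact extsrc_linear : linear extsrc.
Proof.
by move=> k p q; rewrite -[p]extpiK -[q]extpiK -linearP !extsrcE linearP.
Qed.
HB.instance Definition _ :=
  GRing.isLinear.Build K extcell A _ extsrc extsrc_linear.
Fact exttgt_linear : linear exttgt.
Proof.
by move=> k p q; rewrite -[p]extpiK -[q]extpiK -linearP !exttgtE linearP.
Qed.
HB.instance Definition _ :=
  GRing.isLinear.Build K extcell A _ exttgt exttgt_linear.

Lemma extcell_ext (W : lmodType K) (f g : {linear extcell -> W}) :
  (forall a z b, f (extpi (sym a z b)) = g (extpi (sym a z b))) ->
  (forall c, f (extid c) = g (extid c)) -> f =1 g.
Proof.
move=> Es Ei q; rewrite -[q]extpiK.
exact: (preext_ext (f := f \o extpi) (g := g \o extpi)).
Qed.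

Lemma lact_id a c : lact a (extid c) = extid (i0 a * c).
Proof. by rewrite lactE prelact_id. Qed.
Lemma ract_id b c : ract b (extid c) = extid (c * i0 b).
Proof. by rewrite ractE preract_id. Qed.
Lemma extsrc_id c : extsrc (extid c) = c.
Proof. by rewrite extsrcE presrc_id. Qed.
Lemma exttgt_id c : exttgt (extid c) = c.
Proof. by rewrite exttgtE pretgt_id. Qed.
Lemma extsrc_lact a q : extsrc (lact a q) = i0 a * extsrc q.
Proof. by rewrite -[q]extpiK lactE !extsrcE presrc_lact. Qed.
Lemma exttgt_lact a q : exttgt (lact a q) = i0 a * exttgt q.
Proof. by rewrite -[q]extpiK lactE !exttgtE pretgt_lact. Qed.
Lemma extsrc_ract b q : extsrc (ract b q) = extsrc q * i0 b.
Proof. by rewrite -[q]extpiK ractE !extsrcE presrc_ract. Qed.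
Lemma exttgt_ract b q : exttgt (ract b q) = exttgt q * i0 b.
Proof. by rewrite -[q]extpiK ractE !exttgtE pretgt_ract. Qed.

Lemma lact1 q : lact 1 q = q.
Proof.
apply: (extcell_ext (f := lact 1) (g := idfun)) => [a z b|c] /=.
  by rewrite lactE prelact_sym mul1r.
by rewrite lact_id rmorph1 mul1r.
Qed.

Lemma ract1 q : ract 1 q = q.
Proof.
apply: (extcell_ext (f := ract 1) (g := idfun)) => [a z b|c] /=.
  by rewrite ractE preract_sym mulr1.
by rewrite ract_id rmorph1 mulr1.
Qed.

Lemma lactM a a' q : lact (a * a') q = lact a (lact a' q).
Proof.
apply: (extcell_ext (f := lact (a * a')) (g := lact a \o lact a'))
  => [u z b|c] /=.
  by rewrite !lactE !prelact_sym mulrA.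
by rewrite !lact_id rmorphM mulrA.
Qed.

Lemma ractM b b' q : ract (b * b') q = ract b' (ract b q).
Proof.
apply: (extcell_ext (f := ract (b * b')) (g := ract b' \o ract b))
  => [a z u|c] /=.
  by rewrite !ractE !preract_sym mulrA.
by rewrite !ract_id rmorphM mulrA.
Qed.

Lemma lractC a b q : lact a (ract b q) = ract b (lact a q).
Proof.
apply: (extcell_ext (f := lact a \o ract b) (g := ract b \o lact a))
  => [u z v|c] /=.
  by rewrite !(ractE, lactE) !(prelact_sym, preract_sym).
by rewrite !(ract_id, lact_id) mulrA.
Qed.

Lemma lactP k a a' q :
  lact (k *: a + a') q = k *: lact a q + lact a' q.
Proof.
apply: (extcell_ext (f := lact (k *: a + a'))
  (g := (k \*: lact a) \+ lact a')) => [u z b|c] /=.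
  rewrite !lactE !prelact_sym mulrDl -scalerAl -linearP.
  exact/extpiP/rel_linl.
by rewrite !lact_id -extid_linear (linearP i0) mulrDl -scalerAl.
Qed.

Lemma ractP k b b' q :
  ract (k *: b + b') q = k *: ract b q + ract b' q.
Proof.
apply: (extcell_ext (f := ract (k *: b + b'))
  (g := (k \*: ract b) \+ ract b')) => [a z u|c] /=.
  rewrite !ractE !preract_sym mulrDr -scalerAr -linearP.
  exact/extpiP/rel_linr.
by rewrite !ract_id -extid_linear (linearP i0) mulrDr -scalerAr.
Qed.

Definition extsrc0 q := nsrc0 A (extsrc q).
Definition exttgt0 q := ntgt0 A (exttgt q).

Definition extmul (p q : extcell) : extcell :=
  ract (extsrc0 q) p + lact (exttgt0 p) q
  - extid (i0 (exttgt0 p * extsrc0 q)).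

Lemma extmulE x y : extmul (extpi x) (extpi y) = extpi (premulr x y).
Proof.
rewrite /extmul /extsrc0 /exttgt0 extsrcE exttgtE lactE ractE.
by rewrite /premulr (linearB extpi) (linearD extpi).
Qed.

Lemma extmullE p q : extmul p q =
  lact (extsrc0 p) q + ract (exttgt0 q) p
  - extid (i0 (extsrc0 p * exttgt0 q)).
Proof.
rewrite -[p]extpiK -[q]extpiK extmulE.
transitivity (extpi (premull (repr p) (repr q))).
  exact/extpiP/rel_exchange.
rewrite /extsrc0 /exttgt0 !extsrcE !exttgtE lactE ractE.
by rewrite /premull (linearB extpi) (linearD extpi).
Qed.

Lemma extsrcM p q : extsrc (extmul p q) = extsrc p * extsrc q.
Proof. by rewrite -[p]extpiK -[q]extpiK extmulE !extsrcE presrc_mulr. Qed.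
Lemma exttgtM p q : exttgt (extmul p q) = exttgt p * exttgt q.
Proof. by rewrite -[p]extpiK -[q]extpiK extmulE !exttgtE pretgt_mulr. Qed.

Lemma extsrc0M p q : extsrc0 (extmul p q) = extsrc0 p * extsrc0 q.
Proof. by rewrite /extsrc0 extsrcM rmorphM. Qed.
Lemma exttgt0M p q : exttgt0 (extmul p q) = exttgt0 p * exttgt0 q.
Proof. by rewrite /exttgt0 exttgtM rmorphM. Qed.
Lemma extsrc0P k p q : extsrc0 (k *: p + q) = k *: extsrc0 p + extsrc0 q.
Proof. by rewrite /extsrc0 !linearP. Qed.
Lemma exttgt0P k p q : exttgt0 (k *: p + q) = k *: exttgt0 p + exttgt0 q.
Proof. by rewrite /exttgt0 !linearP. Qed.

End FreeExtension.
Section ExtAlgebra.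
Variables (K : fieldType) (B : algType K) (n : nat) (A : nalg B n).
Variables (Z : choiceType) (E : cellext A Z).
Local Notation i0 := (nid0 A).
Implicit Types p q r : extcell E.

Lemma lactDB a p q r :
  lact a (p + q - r) = lact a p + lact a q - lact a r.
Proof. by rewrite linearB linearD. Qed.
Lemma ractDB b p q r :
  ract b (p + q - r) = ract b p + ract b q - ract b r.
Proof. by rewrite linearB linearD. Qed.

Fact extmulA : associative (@extmul K B n A Z E).
Proof.
move=> p q r.
rewrite [extmul p _]/extmul [RHS]/extmul extsrc0M exttgt0M /extmul.
rewrite lactDB ractDB !(ractM, lactM, lact_id, ract_id) -!(rmorphM i0) lractC !mulrA !addrA.
by rewrite [LHS](ACl (1*2*5*3*4))%AC.
Qed.

Fact extmulPl k p q r : extmul (k *: p + q) r = k *: extmul p r + extmul q r.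
Proof.
rewrite /extmul exttgt0P lactP ract_linear mulrDl -scalerAl (linearP i0).
rewrite extid_linear scalerBr scalerDr opprD !addrA.
by rewrite [LHS](ACl (1*3*5*2*4*6))%AC.
Qed.

Fact extmulPr k p q r : extmul r (k *: p + q) = k *: extmul r p + extmul r q.
Proof.
rewrite /extmul extsrc0P ractP lact_linear mulrDr -scalerAr (linearP i0).
rewrite extid_linear scalerBr scalerDr opprD !addrA.
by rewrite [LHS](ACl (1*3*5*2*4*6))%AC.
Qed.

Fact extmulDl : left_distributive (@extmul K B n A Z E) +%R.
Proof. by move=> p q r; have := extmulPl 1 p q r; rewrite !scale1r. Qed.

Fact extmulDr : right_distributive (@extmul K B n A Z E) +%R.
Proof. by move=> p q r; have := extmulPr 1 q r p; rewrite !scale1r. Qed.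

Definition extone : extcell E := extid E 1.

Fact extmul1 : left_id extone (@extmul K B n A Z E).
Proof.
move=> p; rewrite /extmul /extone /exttgt0 exttgt_id rmorph1 lact1 ract_id.
by rewrite !mul1r addrAC subrr add0r.
Qed.

Fact ext1mul : right_id extone (@extmul K B n A Z E).
Proof.
move=> p; rewrite /extmul /extone /extsrc0 extsrc_id rmorph1 ract1 lact_id.
by rewrite !mulr1 addrK.
Qed.

Fact extone_neq0 : extone != 0.
Proof.
apply/eqP => /(congr1 (@extsrc K B n A Z E)); rewrite extsrc_id linear0.
exact/eqP/oner_neq0.
Qed.

HB.instance Definition _ := GRing.Zmodule_isNzRing.Build (extcell E)
  extmulA extmul1 ext1mul extmulDl extmulDr extone_neq0.

Lemma extME p q : p * q = extmul p q. Proof. by []. Qed.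

Fact ext_scaleAl k p q : k *: (p * q) = (k *: p) * q.
Proof.
have := extmulPl k p 0 q.
by rewrite addr0 (mul0r q : extmul 0 q = 0) addr0 => h; exact: esym h.
Qed.
HB.instance Definition _ := GRing.Lmodule_isLalgebra.Build K (extcell E) ext_scaleAl.

Fact ext_scaleAr k p q : k *: (p * q) = p * (k *: q).
Proof.
have := extmulPr k q 0 p.
by rewrite addr0 (mulr0 p : extmul p 0 = 0) addr0 => h; exact: esym h.
Qed.
HB.instance Definition _ := GRing.Lalgebra_isAlgebra.Build K (extcell E) ext_scaleAr.

Fact extsrc_monoid_morphism : monoid_morphism (@extsrc K B n A Z E).
Proof. by split; [exact: extsrc_id | exact: extsrcM]. Qed.
HB.instance Definition _ := GRing.isMonoidMorphism.Build (extcell E) A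
  (@extsrc K B n A Z E) extsrc_monoid_morphism.

Fact exttgt_monoid_morphism : monoid_morphism (@exttgt K B n A Z E).
Proof. by split; [exact: exttgt_id | exact: exttgtM]. Qed.
HB.instance Definition _ := GRing.isMonoidMorphism.Build (extcell E) A
  (@exttgt K B n A Z E) exttgt_monoid_morphism.

Fact extid_monoid_morphism : monoid_morphism (extid E).
Proof.
split=> // c d; rewrite extME /extmul /exttgt0 /extsrc0 exttgt_id extsrc_id.
by rewrite ract_id lact_id -!linearD -linearB -nmulr.
Qed.
HB.instance Definition _ := GRing.isMonoidMorphism.Build A (extcell E)
  (extid E) extid_monoid_morphism.

Definition extpar p q := extsrc p = extsrc q /\ exttgt p = exttgt q.

Definition ext_src0 : {lrmorphism extcell E -> B} :=
  nsrc0 A \o @extsrc K B n A Z E.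
Definition ext_tgt0 : {lrmorphism extcell E -> B} :=
  ntgt0 A \o @exttgt K B n A Z E.
Definition ext_id0 : {lrmorphism B -> extcell E} := extid E \o i0.

Lemma ract_mul b p : ract b p = p * ext_id0 b.
Proof.
rewrite extME /extmul /= /extsrc0 extsrc_id nsrc0K lact_id.
by rewrite (rmorphM i0) addrK.
Qed.
Lemma lact_mul b p : lact b p = ext_id0 b * p.
Proof.
rewrite extME /extmul /= /exttgt0 exttgt_id ntgt0K ract_id.
by rewrite (rmorphM i0) addrAC subrr add0r.
Qed.

Fact ext_src0K : cancel ext_id0 ext_src0.
Proof. by move=> b; rewrite /= extsrc_id nsrc0K. Qed.
Fact ext_tgt0K : cancel ext_id0 ext_tgt0.
Proof. by move=> b; rewrite /= exttgt_id ntgt0K. Qed.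
Fact ext_mulr p q : p * q = p * ext_id0 (ext_src0 q) + ext_id0 (ext_tgt0 p) * q
  - ext_id0 (ext_tgt0 p * ext_src0 q).
Proof. by rewrite -ract_mul -lact_mul. Qed.
Fact ext_mull p q : p * q = ext_id0 (ext_src0 p) * q + p * ext_id0 (ext_tgt0 q)
  - ext_id0 (ext_src0 p * ext_tgt0 q).
Proof. by rewrite -ract_mul -lact_mul; apply: extmullE. Qed.
Fact extpar_refl p : extpar p p. Proof. by []. Qed.
Fact extpar_lin (k : K) a b c d : extpar a b -> extpar c d ->
  extpar (k *: a + c) (k *: b + d).
Proof. by move=> [sa ta] [sc tc]; split; rewrite !linearP /= ?sa ?sc ?ta ?tc. Qed.
Fact extpar_mul a b c d : extpar a b -> extpar c d -> extpar (a * c) (b * d).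
Proof. by move=> [sa ta] [sc tc]; split; rewrite !rmorphM /= ?sa ?sc ?ta ?tc. Qed.
Fact ext_dimS : (0 < n.+1)%N -> forall a b, extpar a b ->
  ext_src0 a = ext_src0 b /\ ext_tgt0 a = ext_tgt0 b.
Proof. by move=> _ a b [/= -> ->]. Qed.

Fact ext_dim0 : n.+1 = 0%N -> forall a,
  ext_id0 (ext_src0 a) = a /\ ext_id0 (ext_tgt0 a) = a.
Proof. by []. Qed.

(* A[Z] *)
Definition freeext : nalg B n.+1 :=
  @NAlg K B n.+1 (extcell E) ext_src0 ext_tgt0 ext_id0 extpar
    ext_src0K ext_tgt0K ext_mulr ext_mull extpar_refl extpar_lin extpar_mul
    ext_dim0 ext_dimS.

Definition extgen (z : Z) : extcell E := extpi E (sym A 1 z 1).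
End ExtAlgebra.

Section Dim0.
Variables (K : fieldType) (B : algType K).
Let B_id : {lrmorphism B -> B} := @idfun B.
Fact nalg0_mul (a b : B) : a * b = a * B_id b + B_id a * b - B_id (a * b).
Proof. by rewrite addrK. Qed.

Definition nalg0 : nalg B 0 :=
  @NAlg K B 0 B B_id B_id B_id (fun _ _ => True)
    (fun _ => erefl) (fun _ => erefl) nalg0_mul nalg0_mul
    (fun _ => I) (fun _ _ _ _ _ _ _ => I) (fun _ _ _ _ _ _ => I)
    (fun _ _ => conj erefl erefl) (fun n0 => False_ind _ (notF n0)).
End Dim0.

(** * Infinity-algebras *)

Section Iterated.
Variables (K : fieldType) (A : nat -> algType K).
Variables (s : forall n, A n.+1 -> A n) (i : forall n, A n -> A n.+1).

Fixpoint iter_bd k m : A (m + k) -> A k :=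
  if m is m'.+1 then fun a => iter_bd (s a) else id.

Fixpoint iter_id k m : A k -> A (m + k) :=
  if m is m'.+1 then fun a => i (iter_id m' a) else id.
End Iterated.
Arguments iter_bd {K A} s k m a.
Arguments iter_id {K A} i k m a.

(* Linearity forces the composite along dimension k of two cells a, b of       *)
(* dimension m + 1 + k with t_k(a) = s_k(b) to be a - 1_{t_k(a)} + b, hence    *)
(* composition is not a separate operation.  For this formula the axioms of    *)
(* strict oo-categories (sources, targets, units, associativity, interchange)  *)
(* are consequences of the globular ones; [oocomp_mul] is the remaining        *)
(* requirement, that composition be a morphism of algebras.                    *)
Record ooalg (K : fieldType) := OOAlg {
  oocell :> nat -> algType K;
  oosrc : forall n, {lrmorphism oocell n.+1 -> oocell n};
  ootgt : forall n, {lrmorphism oocell n.+1 -> oocell n};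
  ooid : forall n, {lrmorphism oocell n -> oocell n.+1};
  oosrc_st : forall n a, oosrc n (oosrc n.+1 a) = oosrc n (ootgt n.+1 a);
  ootgt_st : forall n a, ootgt n (oosrc n.+1 a) = ootgt n (ootgt n.+1 a);
  oosrcK : forall n, cancel (ooid n) (oosrc n);
  ootgtK : forall n, cancel (ooid n) (ootgt n);
  oocomp_mul :
    let s_ := iter_bd (A := oocell) oosrc in
    let t_ := iter_bd (A := oocell) ootgt in
    let comp k m (a b : oocell (m.+1 + k)) :=
      a - iter_id (A := oocell) ooid k m.+1 (t_ k m.+1 a) + b in
    forall k m (a b c d : oocell (m.+1 + k)),
      t_ k m.+1 a = s_ k m.+1 b -> t_ k m.+1 c = s_ k m.+1 d ->
      comp k m (a * c) (b * d) = comp k m a b * comp k m c d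
}.

Record oomorphism (K : fieldType) (A B : ooalg K) := OOMorphism {
  oomap :> forall n, {lrmorphism A n -> B n};
  oomap_src : forall n (a : A n.+1), oomap n (oosrc A n a) = oosrc B n (oomap n.+1 a);
  oomap_tgt : forall n (a : A n.+1), oomap n (ootgt A n a) = ootgt B n (oomap n.+1 a);
  oomap_id : forall n (a : A n), oomap n.+1 (ooid A n a) = ooid B n (oomap n a)
}.

(** * Polygraphs *)

(* The cellular extensions of a polygraph with cells X, from dimension n on,   *)
(* over the n-algebra A generated by its cells of dimension at most n.         *)
#[projections(primitive)]
CoInductive cellexts (K : fieldType) (B : algType K) (X : nat -> choiceType)
    (n : nat) (A : nalg B n) : Type := CellExts {
  cehead : cellext A (X n.+1);
  cetail : cellexts X (freeext cehead)
}.

(* A structure of oo-polygraph on the indexed set X. *)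
Definition pstruct (K : fieldType) (X : nat -> choiceType) : Type :=
  cellexts X (nalg0 (freealg K (X 0%N))).

Record polygraph (K : fieldType) := Polygraph {
  pcell :> nat -> choiceType;
  pcells : pstruct K pcell
}.

Section FreeOOAlg.
Variables (K : fieldType) (X : polygraph K).
Local Notation B := (freealg K (X 0%N)).

Fixpoint pstage n : {A : nalg B n & cellexts X A} :=
  if n is m.+1
  then existT _ (freeext (cehead (projT2 (pstage m)))) (cetail (projT2 (pstage m)))
  else existT _ (nalg0 B) (pcells X).

(* The free n-algebra A(X_0)[X_1]...[X_n], and its extension X_{n+1}. *)
Definition ptrunc n : nalg B n := projT1 (pstage n).
Definition pext n : cellext (ptrunc n) (X n.+1) := cehead (projT2 (pstage n)).

Definition psrc n : {lrmorphism ptrunc n.+1 -> ptrunc n} :=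
  @extsrc K B n (ptrunc n) (X n.+1) (pext n).
Definition ptgt n : {lrmorphism ptrunc n.+1 -> ptrunc n} :=
  @exttgt K B n (ptrunc n) (X n.+1) (pext n).
Definition pid n : {lrmorphism ptrunc n -> ptrunc n.+1} := extid (pext n).

Lemma ppar n (a : ptrunc n.+1) : npar (psrc n a) (ptgt n a).
Proof. exact: prepar. Qed.

Local Notation s_ := (iter_bd (A := ptrunc) psrc).
Local Notation t_ := (iter_bd (A := ptrunc) ptgt).
Local Notation i_ := (iter_id (A := ptrunc) pid).

Lemma iter_bdM (d : forall n, {lrmorphism ptrunc n.+1 -> ptrunc n}) k m a b :
  iter_bd (A := ptrunc) d k m (a * b)
  = iter_bd (A := ptrunc) d k m a * iter_bd (A := ptrunc) d k m b.
Proof. by elim: m a b => //= m IHm a b; rewrite rmorphM IHm. Qed.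

Lemma iter_idM k m a b : i_ k m (a * b) = i_ k m a * i_ k m b.
Proof. by elim: m => //= m ->; rewrite rmorphM. Qed.

Lemma iter_id0 m c : i_ 0%N m c = nid0 (ptrunc (m + 0)) c.
Proof. by elim: m => //= m ->. Qed.

Lemma src0_s k m a : nsrc0 (ptrunc k) (s_ k m a) = nsrc0 _ a.
Proof. by elim: m a => //= m IHm a; rewrite IHm. Qed.
Lemma tgt0_t k m a : ntgt0 (ptrunc k) (t_ k m a) = ntgt0 _ a.
Proof. by elim: m a => //= m IHm a; rewrite IHm. Qed.

Lemma src0_t k m a : (0 < k)%N -> nsrc0 (ptrunc k) (t_ k m a) = nsrc0 _ a.
Proof.
move=> k_gt0; elim: m a => //= m IHm a; rewrite IHm.
by have [] := ndimS (ltn_addl m k_gt0) (ppar a).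
Qed.
Lemma tgt0_s k m a : (0 < k)%N -> ntgt0 (ptrunc k) (s_ k m a) = ntgt0 _ a.
Proof.
move=> k_gt0; elim: m a => //= m IHm a; rewrite IHm.
by have [] := ndimS (ltn_addl m k_gt0) (ppar a).
Qed.
Lemma src0_i k m c : nsrc0 _ (i_ k m c) = nsrc0 _ c.
Proof. by elim: m => //= m IHm; rewrite extsrc_id. Qed.
Lemma tgt0_i k m c : ntgt0 _ (i_ k m c) = ntgt0 _ c.
Proof. by elim: m => //= m IHm; rewrite exttgt_id. Qed.

Fact psrc_st n a : psrc n (psrc n.+1 a) = psrc n (ptgt n.+1 a).
Proof. exact: proj1 (ppar a). Qed.
Fact ptgt_st n a : ptgt n (psrc n.+1 a) = ptgt n (ptgt n.+1 a).
Proof. exact: proj2 (ppar a). Qed.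
Fact psrcK n : cancel (pid n) (psrc n). Proof. exact: extsrc_id. Qed.
Fact ptgtK n : cancel (pid n) (ptgt n). Proof. exact: exttgt_id. Qed.

Fact pcomp_mul k m (a b c d : ptrunc (m.+1 + k)) :
  t_ k m.+1 a = s_ k m.+1 b -> t_ k m.+1 c = s_ k m.+1 d ->
  a * c - i_ k m.+1 (t_ k m.+1 (a * c)) + b * d
  = (a - i_ k m.+1 (t_ k m.+1 a) + b) * (c - i_ k m.+1 (t_ k m.+1 c) + d).
Proof.
move=> ab cd; rewrite iter_bdM iter_idM.
set e := i_ k m.+1 (t_ _ _ a); set f := i_ k m.+1 (t_ _ _ c).
have [k0|k_gt0] := posnP k.
  subst k; rewrite /e /f !iter_id0.
  apply: ncomp_mul0; [by rewrite -tgt0_t|by rewrite ab -src0_s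
    |by rewrite -tgt0_t|by rewrite cd -src0_s].
apply: ncomp_mulS.
- by rewrite src0_i src0_t.
- by rewrite tgt0_i tgt0_t.
- by rewrite src0_i ab src0_s.
- by rewrite tgt0_i ab tgt0_s.
- by rewrite src0_i src0_t.
- by rewrite tgt0_i tgt0_t.
- by rewrite src0_i cd src0_s.
- by rewrite tgt0_i cd tgt0_s.
Qed.

(* A(X) *)
Definition freeoo : ooalg K :=
  @OOAlg K ptrunc psrc ptgt pid psrc_st ptgt_st psrcK ptgtK pcomp_mul.

Definition pgen n : X n -> freeoo n :=
  match n with
  | 0 => fun x => << fmu x >>
  | m.+1 => fun x => extgen (pext m) x
  end.
End FreeOOAlg.

(** * Polygraphic resolutions *)

(* Unital associative algebras; unlike [algType], the zero algebra is included, *)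
(* as it is presented by some polygraphs.                                       *)
Record algebra (K : fieldType) := Algebra {
  aring :> pzRingType;
  ascal : {rmorphism K -> aring};
  ascal_central : forall k x, ascal k * x = x * ascal k
}.

Definition alg_iso (K : fieldType) (A B : algebra K) : Prop :=
  exists2 f : {rmorphism A -> B}, bijective f & forall k, f (ascal A k) = ascal B k.

Section IdealQuotient.
Variables (K : fieldType) (R : algType K) (G : R -> Prop).

Inductive ideal_gen : R -> Prop :=
| ideal_gen_in x : G x -> ideal_gen x
| ideal_gen0 : ideal_gen 0
| ideal_genB x y : ideal_gen x -> ideal_gen y -> ideal_gen (x - y)
| ideal_genMl a x : ideal_gen x -> ideal_gen (a * x)
| ideal_genMr a x : ideal_gen x -> ideal_gen (x * a).

Definition ideal_pred : {pred R} := fun x => `[< ideal_gen x >].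

Fact ideal_zmod_closed : zmod_closed ideal_pred.
Proof.
split; first exact/asboolP/ideal_gen0.
by move=> x y /asboolP ix /asboolP iy; apply/asboolP/ideal_genB.
Qed.
HB.instance Definition _ := GRing.isZmodClosed.Build R ideal_pred ideal_zmod_closed.

Definition ideal_quot := Quotient.quot ideal_pred.
HB.instance Definition _ := GRing.Zmodule.on ideal_quot.

Definition ideal_pi (x : R) : ideal_quot := \pi x.

Lemma ideal_piP x y : ideal_pi x = ideal_pi y <-> ideal_gen (x - y).
Proof.
have h : (ideal_pi x == ideal_pi y) = `[< ideal_gen (x - y) >].
  by rewrite eqquotE Quotient.equivE.
by split=> [/eqP|r]; [rewrite h => /asboolP|apply/eqP; rewrite h; apply/asboolP].
Qed.

Lemma ideal_piK (q : ideal_quot) : ideal_pi (repr q) = q.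
Proof. exact: reprK. Qed.

Fact ideal_piB : zmod_morphism ideal_pi.
Proof. by move=> x y; rewrite /ideal_pi !piE. Qed.
HB.instance Definition _ :=
  GRing.isZmodMorphism.Build R ideal_quot ideal_pi ideal_piB.

Definition ideal_mul (p q : ideal_quot) : ideal_quot := ideal_pi (repr p * repr q).

Lemma ideal_piM x y : ideal_pi (x * y) = ideal_mul (ideal_pi x) (ideal_pi y).
Proof.
apply/ideal_piP; set x' := repr _; set y' := repr _.
have ix : ideal_gen (x - x') by apply/ideal_piP; rewrite ideal_piK.
have iy : ideal_gen (y - y') by apply/ideal_piP; rewrite ideal_piK.
have -> : x * y - x' * y' = (x - x') * y - x' * (y' - y).
  by rewrite mulrBl mulrBr opprB addrA addrNK.
apply: ideal_genB; first exact: ideal_genMr.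
by apply: ideal_genMl; rewrite -opprB -sub0r; apply: ideal_genB => //; exact: ideal_gen0.
Qed.

Fact ideal_mulA : associative ideal_mul.
Proof.
move=> p q r; rewrite -[p]ideal_piK -[q]ideal_piK -[r]ideal_piK.
by rewrite -!ideal_piM mulrA.
Qed.
Fact ideal_mul1 : left_id (ideal_pi 1) ideal_mul.
Proof. by move=> p; rewrite -[p]ideal_piK -!ideal_piM mul1r. Qed.
Fact ideal_1mul : right_id (ideal_pi 1) ideal_mul.
Proof. by move=> p; rewrite -[p]ideal_piK -!ideal_piM mulr1. Qed.
Fact ideal_mulDl : left_distributive ideal_mul +%R.
Proof.
move=> p q r; rewrite -[p]ideal_piK -[q]ideal_piK -[r]ideal_piK.
by rewrite -raddfD -!ideal_piM mulrDl raddfD.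
Qed.
Fact ideal_mulDr : right_distributive ideal_mul +%R.
Proof.
move=> p q r; rewrite -[p]ideal_piK -[q]ideal_piK -[r]ideal_piK.
by rewrite -raddfD -!ideal_piM mulrDr raddfD.
Qed.
HB.instance Definition _ := GRing.Zmodule_isPzRing.Build ideal_quot
  ideal_mulA ideal_mul1 ideal_1mul ideal_mulDl ideal_mulDr.

Definition ideal_scal (k : K) : ideal_quot := ideal_pi (k *: 1).
Fact ideal_scalB : zmod_morphism ideal_scal.
Proof. by move=> j k; rewrite /ideal_scal scalerBl raddfB. Qed.
HB.instance Definition _ :=
  GRing.isZmodMorphism.Build K ideal_quot ideal_scal ideal_scalB.
Fact ideal_scalM : monoid_morphism ideal_scal.
Proof.
split=> [|j k]; first by rewrite /ideal_scal scale1r.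
by rewrite -[RHS]ideal_piM -scalerAl mul1r scalerA.
Qed.
HB.instance Definition _ :=
  GRing.isMonoidMorphism.Build K ideal_quot ideal_scal ideal_scalM.

Fact ideal_scal_central k p : ideal_scal k * p = p * ideal_scal k.
Proof.
rewrite -[p]ideal_piK -[LHS]ideal_piM -[RHS]ideal_piM.
by rewrite -scalerAl -scalerAr mul1r mulr1.
Qed.

Definition quot_alg : algebra K := Algebra ideal_scal_central.
End IdealQuotient.

Section Resolution.
Variables (K : fieldType) (X : polygraph K).

Definition pcsrc n (x : X n.+1) : freeoo X n := cesrc (pext X n) x.
Definition pctgt n (x : X n.+1) : freeoo X n := cetgt (pext X n) x.

Lemma psrc_gen n (x : X n.+1) : oosrc (freeoo X) n (pgen x) = pcsrc x.
Proof. by rewrite /= extsrcE presrc_sym !rmorph1 mul1r mulr1. Qed.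
Lemma ptgt_gen n (x : X n.+1) : ootgt (freeoo X) n (pgen x) = pctgt x.
Proof. by rewrite /= exttgtE pretgt_sym !rmorph1 mul1r mulr1. Qed.

Definition presented : algebra K :=
  @quot_alg K (freeoo X 0%N) (fun r => exists x : X 1%N, r = pcsrc x - pctgt x).

End Resolution.

Definition acyclic (K : fieldType) (B : algType K) (n : nat) (A : nalg B n)
    (Z : choiceType) (E : cellext A Z) : Prop :=
  forall a b : A, npar a b -> exists c : freeext E,
    @extsrc K B n A Z E c = a /\ @exttgt K B n A Z E c = b.

Definition is_resolution (K : fieldType) (X : polygraph K) (A : algebra K) : Prop :=
  alg_iso (presented X) A /\ forall n, (0 < n)%N -> acyclic (pext X n).

(** * Collapsing schemes *)

Section Cells.
Variables (K : fieldType) (X : polygraph K).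
Local Notation word := {fmonom (X 0%N)}.

Definition pboundary n (a : freeoo X n.+1) : freeoo X n :=
  oosrc (freeoo X) n a - ootgt (freeoo X) n a.

(* The n-monomial u x v. *)
Definition pmonomial n (m : word * X n * word) : freeoo X n :=
  nid0 (ptrunc X n) << m.1.1 >> * pgen m.1.2 * nid0 (ptrunc X n) << m.2 >>.

(* a is the linear combination, given by l, of pairwise distinct               *)
(* (n+1)-monomials, plus an identity.                                          *)
Definition decomposes n (a : freeoo X n.+1) (l : seq (K * (word * X n.+1 * word))) :=
  uniq [seq pmonomial m.2 | m <- l] /\
  exists c : freeoo X n, a = \sum_(m <- l) m.1 *: pmonomial m.2 + ooid (freeoo X) n c.

Definition min_decomposes n (a : freeoo X n.+1) l :=
  decomposes a l /\ forall l', decomposes a l' -> (size l <= size l')%N.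

Definition is_cell n : freeoo X n -> (X n -> Prop) -> Prop :=
  match n with
  | 0 => fun a S => forall x, S x <->
      exists2 w : word, w \in msupp (a : freealg K (X 0%N)) & x \in (w : seq _)
  | m.+1 => fun a S => exists2 l, min_decomposes a l &
      forall x, S x <-> x \in [seq d.2.1.2 | d <- l]
  end.

(* In dimension 1, minimal decompositions of a may involve different cells:    *)
(* x (s(y) - t(y)) and (s(x) - t(x)) y differ by an identity.  [cell] may be   *)
(* any function that selects, for each a, the cells of one of them.            *)
Record cellmap := CellMap {
  cell :> forall n, freeoo X n -> X n -> Prop;
  cellP : forall n (a : freeoo X n), is_cell a (cell a)
}.
End Cells.

Section CollapsingScheme.
Variables (K : fieldType) (X : polygraph K).

Definition in_dom (phi : forall n, X n -> option (X n.+1)) n (x : X n) : Prop :=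
  exists z, phi n x = Some z.

Definition in_im (phi : forall n, X n -> option (X n.+1)) n : X n -> Prop :=
  match n with
  | 0 => fun _ => False
  | m.+1 => fun z => exists x, phi m x = Some z
  end.

Definition wf_order (T : Type) (R : T -> T -> Prop) : Prop :=
  [/\ forall x, R x x, forall x y z, R x y -> R y z -> R x z,
      forall x y, R x y -> R y x -> x = y
    & well_founded (fun y x => R x y /\ x <> y)].

(* The boundary of phi_x is written lambda x + a, with lambda = cs_coef x,     *)
(* a = cs_rest x and x not in cell(a); its cells are those of that expression, *)
(* i.e. x and the elements of cell(a).  This only makes a difference where     *)
(* minimal decompositions are ambiguous: another minimal decomposition of the  *)
(* boundary may hide cells that are needed to express a.                       *)
Inductive collapse_gen (cell : forall n, freeoo X n -> X n -> Prop)
    (phi : forall n, X n -> option (X n.+1)) (rest : forall n, X n -> freeoo X n) :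
    {n & X n} -> {n & X n} -> Prop :=
| CollapseGen n (x y : X n) : in_dom phi x -> y = x \/ cell n (rest n x) y ->
    collapse_gen cell phi rest (existT _ n x) (existT _ n y).

Record collapsing_scheme (cell : cellmap X) (Y : forall n, pred (X n)) :=
  CollapsingScheme {
  cs_map :> forall n, X n -> option (X n.+1);
  cs_coef : forall n, X n -> K;
  cs_rest : forall n, X n -> freeoo X n;
  cs_inj : forall n (x y : X n) z,
    cs_map x = Some z -> cs_map y = Some z -> x = y;
  cs_cover : forall n (x : X n), [\/ in_im cs_map x, Y n x | in_dom cs_map x];
  cs_disjoint : forall n (x : X n),
    [/\ ~ (in_im cs_map x /\ Y n x), ~ (in_im cs_map x /\ in_dom cs_map x)
      & ~ (Y n x /\ in_dom cs_map x)];
  cs_boundary : forall n (x : X n) z, cs_map x = Some z ->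
    [/\ cs_coef x != 0, pboundary (pgen z) = cs_coef x *: pgen x + cs_rest x
      & ~ cell n (cs_rest x) x];
  cs_wf : wf_order (clos_refl_trans _ (collapse_gen cell cs_map cs_rest))
}.

Definition subcells (Y : forall n, pred (X n)) (n : nat) : choiceType :=
  {x : X n | Y n x}.

(* The cell x tilde, to which x is sent. *)
Definition cs_tilde (cell : cellmap X) (Y : forall n, pred (X n))
    (phi : collapsing_scheme cell Y) n (x : X n) : freeoo X n :=
  - (cs_coef phi x)^-1 *: cs_rest phi x.

Record induced (cell : cellmap X) (Y : forall n, pred (X n))
    (phi : collapsing_scheme cell Y) (T : pstruct K (subcells Y))
    (pi : oomorphism (freeoo X) (freeoo (Polygraph T))) : Prop := Induced {
  ind_src : forall n (y : subcells Y n.+1),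
    @pcsrc K (Polygraph T) n y = pi n (pcsrc (val y));
  ind_tgt : forall n (y : subcells Y n.+1),
    @pctgt K (Polygraph T) n y = pi n (pctgt (val y));
  ind_crit : forall n (y : subcells Y n), pi n (pgen (val y)) = @pgen K (Polygraph T) n y;
  ind_dom : forall n (x : X n), in_dom phi x -> pi n (pgen x) = pi n (cs_tilde phi x);
  ind_im : forall n (x : X n.+1), in_im phi x ->
    pi n.+1 (pgen x) = ooid (freeoo (Polygraph T)) n (pi n (pcsrc x))
}.
End CollapsingScheme.

(* Main.v *)
Set Warnings "-notation-incompatible-prefix,-notation-overridden,-deprecated,-ambiguous-paths,-redundant-canonical-projection".
Require Import Defs.
From mathcomp Require Import all_boot all_algebra.
From HB Require Import structures.
From mathcomp Require Import finmap monalg boolp.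
From Stdlib Require Import Relation_Operators Eqdep_dec PeanoNat.

Set Implicit Arguments.
Unset Strict Implicit.
Unset Printing Implicit Defensive.

Import GRing.Theory.
Local Open Scope ring_scope.

(** The projection [pi] from A(X) to A(Y) is a deformation retraction, and a
    filler in A(X) projects to a filler in A(Y).

    Existence of the induced structure. [pi] is built one dimension at a time.
    Its values on the cells of dimension n + 1 come from a recursion along the
    order of the scheme, as x in the domain goes to the image of x~ ([cs_recS]).
    They have the right sources and targets: x and x~ are parallel because the
    boundary of the boundary of phi_x is zero, and the source and the target of
    phi_w have the same image because their difference lambda w + a is killed by
    [pi], which sends w to the image of w~ = - a / lambda. The universal property
    of A[Z] ([ext_lift]) then extends [pi] to all (n+1)-cells.

    Resolution. In each dimension n there are a section [iota] of [pi], which is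
    a morphism of algebras preserving parallelism, and a linear map [h] from
    n-cells to (n+1)-cells of A(X) which is a homotopy from the identity to
    iota pi and vanishes under [pi] ([contraction]). Write d(c) for
    t(c) - s(c). As in discrete Morse theory, on generators
      - iota(y) is y + h(d(y)) up to an identity;
      - h vanishes on Y and on the image of phi, in positive dimension;
      - for x in the domain, h(x) solves lambda h(x) + h(a) = phi_x - 1_{s(phi_x)},
        by recursion along the order.
    The homotopy identity iota pi = id + t h + h d, which holds up to identities
    ([htpy]), is first proved on generators ([htpy_crit], [htpy_im],
    [htpy_dom]), then extended to products ([htpy_mul]). For n > 0 the map [h]
    is a morphism of bimodules, as boundaries of 1-cells act by zero on cells
    of dimension at least 2 with null source ([mul_src_tgt0]); in dimension 0 it
    is the derivation associated with a morphism of algebras giving a 1-cell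
    a -> iota pi a for each a ([link_exists]). Both cases satisfy the same weak
    multiplicativity [ct_mul], which is what the induction on n uses.

    If a and b are parallel n-cells of A(Y), n > 0, then iota(a) and iota(b) are
    parallel, acyclicity of X gives an (n+1)-cell between them, and [pi] sends it
    to a cell a -> b. In dimension 0 the 1-cells a -> iota pi a show that [pi] and
    [iota] are inverse to each other modulo the relations of X and of Y, so both
    polygraphs present the same algebra. *)

(** * Morphisms out of free algebras *)

Section FreeAlgebraLift.
Variables (K : fieldType) (X : choiceType) (C : algType K).

Definition word_eval (g : X -> C) (w : {fmonom X}) : C :=
  \prod_(x <- (w : seq X)) g x.

Definition fa_lift (g : X -> C) (a : freealg K X) : C := flin (word_eval g) a.

Fact fa_lift_linear g : linear (fa_lift g).
Proof. exact: flin_is_linear. Qed.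
HB.instance Definition _ g :=
  GRing.isLinear.Build K (freealg K X) C _ (fa_lift g) (fa_lift_linear g).

Lemma fa_liftU g w : fa_lift g << w >> = word_eval g w.
Proof. exact: flinU. Qed.

Lemma freealgE (a : freealg K X) : a = \sum_(w <- msupp a) a@_w *: << w >>.
Proof. exact: freemodE. Qed.

Lemma freealgUM (v w : {fmonom X}) :
  (<< v >> : freealg K X) * << w >> = << mmul v w >>.
Proof. by rewrite -[LHS]/(fgmul _ _) fgmulUU mulr1. Qed.

Fact fa_lift_monoid g : monoid_morphism (fa_lift g).
Proof.
split=> [|a b].
  by rewrite -[1]/(<< mone >> : freealg K X) fa_liftU /word_eval fm1 big_nil.
rewrite (freealgE a) mulr_suml !linear_sum mulr_suml; apply: eq_bigr => v _.
rewrite -scalerAl !(linearZ_LR (fa_lift g)) -scalerAl; congr (_ *: _).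
rewrite (freealgE b) mulr_sumr !linear_sum mulr_sumr; apply: eq_bigr => w _.
rewrite -scalerAr !(linearZ_LR (fa_lift g)) /= -scalerAr; congr (_ *: _).
by rewrite freealgUM !fa_liftU /word_eval fmM big_cat.
Qed.
HB.instance Definition _ g :=
  GRing.isMonoidMorphism.Build (freealg K X) C (fa_lift g) (fa_lift_monoid g).

Lemma fa_lift_gen g x : fa_lift g << fmu x >> = g x.
Proof. by rewrite fa_liftU /word_eval fmU big_seq1. Qed.

Lemma lrmorph_word (f : {lrmorphism freealg K X -> C}) w :
  f << w >> = word_eval (fun x => f << fmu x >>) w.
Proof.
case: w; rewrite /word_eval /=; elim=> [|x s IHs].
  rewrite big_nil -[RHS](rmorph1 f); congr (f << _ >>).
  by apply/val_inj; rewrite /= fm1.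
rewrite big_cons -IHs -rmorphM freealgUM; congr (f << _ >>).
by apply/val_inj; rewrite /= fmM fmU.
Qed.

(** Agreement is only asked on the letters of [a]: during a recursion along a
    scheme, two morphisms are compared on smaller cells alone. *)
Lemma fa_ext (f1 f2 : {lrmorphism freealg K X -> C}) (a : freealg K X) :
  (forall w x, w \in msupp a -> x \in (w : seq X) ->
     f1 << fmu x >> = f2 << fmu x >>) -> f1 a = f2 a.
Proof.
move=> E; rewrite {1 2}(freealgE a) !linear_sum !big_seq; apply: eq_bigr => w wa.
rewrite !linearZ /=; congr (_ *: _); rewrite !lrmorph_word.
by rewrite /word_eval !big_seq; apply: eq_bigr => x xw; apply: (E w).
Qed.
End FreeAlgebraLift.

(** * Maps out of a free cellular extension *)

Section ExtEval.
Variables (K : fieldType) (B : algType K) (n : nat) (A : nalg B n).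
Variables (Z : choiceType) (E : cellext A Z).
Variables (C : algType K) (i : {lrmorphism B -> C}) (u : {linear A -> C}).
Variable g : Z -> C.
Local Notation i0 := (nid0 A).

(** Two kinds of maps out of A[Z] have this shape: morphisms of algebras, where
    [u] comes from a morphism out of A, and maps that raise the dimension and
    kill identities, where [u] is zero. *)
Definition preeval (x : preext A Z) : C :=
  flin (fun w => i w.1.1 * g w.1.2 * i w.2) x.1 + u x.2.

Fact preeval_linear : linear preeval.
Proof. by move=> k x y; rewrite /preeval /= !linearP scalerDr addrACA. Qed.
HB.instance Definition _ :=
  GRing.isLinear.Build K (preext A Z) C _ preeval preeval_linear.

Lemma preeval_sym a z b : preeval (sym A a z b) = i a * g z * i b.
Proof. by rewrite /preeval flinU linear0 addr0. Qed.
Lemma preeval_id c : preeval (preid Z c) = u c.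
Proof. by rewrite /preeval linear0 add0r. Qed.

Hypothesis ul : forall a c, u (i0 a * c) = i a * u c.
Hypothesis ur : forall b c, u (c * i0 b) = u c * i b.

Lemma preeval_lact a x : preeval (prelact a x) = i a * preeval x.
Proof.
apply: (preext_ext (f := preeval \o prelact a) (g := i a \*o preeval)) => /=.
  by move=> a' z b; rewrite prelact_sym !preeval_sym rmorphM !mulrA.
by move=> c; rewrite prelact_id !preeval_id.
Qed.

Lemma preeval_ract b x : preeval (preract b x) = preeval x * i b.
Proof.
apply: (preext_ext (f := preeval \o preract b) (g := i b \o* preeval)) => /=.
  by move=> a z b'; rewrite preract_sym !preeval_sym rmorphM !mulrA.
by move=> c; rewrite preract_id !preeval_id.
Qed.

Hypothesis exch : forall x y, preeval (premulr E x y) = preeval (premull E x y).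

Lemma preeval_sound x : extrel E x -> preeval x = 0.
Proof.
elim=> [k a a' z b|k a z b b'|{}x y|k {}x y _ hx _ hy|a {}x _ hx|b {}x _ hx].
- rewrite (linearB preeval) (linearP preeval) /= !preeval_sym (linearP i).
  by rewrite !mulrDl -!scalerAl subrr.
- rewrite (linearB preeval) (linearP preeval) /= !preeval_sym (linearP i).
  by rewrite !mulrDr -!scalerAr subrr.
- by rewrite linearB /= exch subrr.
- by rewrite linearP /= hx hy scaler0 addr0.
- by rewrite preeval_lact hx mulr0.
- by rewrite preeval_ract hx mul0r.
Qed.

(** When [u] commutes with both actions, exchange is the only relation of A[Z]
    that does not hold automatically. *)
Lemma ext_eval :
  {F : {linear extcell E -> C} | forall x, F (extpi E x) = preeval x}.
Proof.
pose F (q : extcell E) := preeval (repr q).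
have FE x : F (extpi E x) = preeval x.
  apply/subr0_eq; rewrite -linearB; apply: preeval_sound.
  by apply/extpiP; rewrite extpiK.
have Fl : linear F.
  move=> k p q; rewrite -[p]extpiK -[q]extpiK -(linearP (extpi E)) !FE.
  by rewrite linearP.
pose Fi := GRing.isLinear.Build K (extcell E) C _ F Fl.
by exists (HB.pack F Fi : {linear extcell E -> C}).
Qed.
End ExtEval.

Lemma linear_subZ0 (K : fieldType) (U V : lmodType K) (w : {linear U -> V})
    (k : K) (a b : U) : w a = 0 -> w b = 0 -> w (a - k *: b) = 0.
Proof.
by move=> a0 b0; rewrite (linearB w) (linearZ_LR w) /= a0 b0 scaler0 subrr.
Qed.

Lemma linear_Zsub0 (K : fieldType) (U V : lmodType K) (w : {linear U -> V})
    (k : K) (a b : U) : w a = w b -> w (k *: (a - b)) = 0.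
Proof. by move=> e; rewrite (linearZ_LR w) (linearB w) /= e subrr scaler0. Qed.

(** When a factor has a null 0-source or a null 0-target, two of the three terms
    of the product formula vanish, and the product reduces to an action of
    0-cells. *)
Section NalgMul.
Variables (K : fieldType) (B : algType K) (n : nat) (A : nalg B n).
Local Notation i0 := (nid0 A).
Local Notation s0 := (nsrc0 A).
Local Notation t0 := (ntgt0 A).
Implicit Types p q : A.

Lemma nmulr_src0 p q : s0 q = 0 -> p * q = i0 (t0 p) * q.
Proof. by move=> q0; rewrite nmulr q0 mulr0 !(raddf0 i0) mulr0 add0r subr0. Qed.
Lemma nmulr_tgt0 p q : t0 q = 0 -> p * q = i0 (s0 p) * q.
Proof. by move=> q0; rewrite nmull q0 mulr0 !(raddf0 i0) mulr0 addr0 subr0. Qed.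
Lemma nmull_src0 p q : s0 p = 0 -> p * q = p * i0 (t0 q).
Proof. by move=> p0; rewrite nmull p0 mul0r !(raddf0 i0) mul0r add0r subr0. Qed.
Lemma nmull_tgt0 p q : t0 p = 0 -> p * q = p * i0 (s0 q).
Proof. by move=> p0; rewrite nmulr p0 mul0r !(raddf0 i0) mul0r addr0 subr0. Qed.
End NalgMul.

Section ExtSym.
Variables (K : fieldType) (B : algType K) (n : nat) (A : nalg B n).
Variables (Z : choiceType) (E : cellext A Z).

Lemma ext_symE a z b :
  extpi E (sym A a z b) = ext_id0 E a * extgen E z * ext_id0 E b.
Proof.
by rewrite -lact_mul -ract_mul /extgen lactE prelact_sym ractE preract_sym
  mul1r mulr1.
Qed.

Lemma ext_ext (W : lmodType K) (f g : {linear extcell E -> W}) :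
  (forall a z b, f (ext_id0 E a * extgen E z * ext_id0 E b)
               = g (ext_id0 E a * extgen E z * ext_id0 E b)) ->
  (forall c, f (extid E c) = g (extid E c)) -> f =1 g.
Proof. by move=> h hi; apply: extcell_ext => // a z b; rewrite ext_symE. Qed.

Lemma extsrc_gen z : extsrc (extgen E z) = cesrc E z.
Proof. by rewrite extsrcE presrc_sym !rmorph1 mul1r mulr1. Qed.
Lemma exttgt_gen z : exttgt (extgen E z) = cetgt E z.
Proof. by rewrite exttgtE pretgt_sym !rmorph1 mul1r mulr1. Qed.
Lemma extpar_sub (p q : extcell E) :
  extpar p q -> extsrc (p - q) = 0 /\ exttgt (p - q) = 0.
Proof.
move=> [s t]; rewrite (linearB (@extsrc _ _ _ _ _ E)).
by rewrite (linearB (@exttgt _ _ _ _ _ E)) /= s t !subrr.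
Qed.
End ExtSym.

Section ExtLift.
Variables (K : fieldType) (B : algType K) (n : nat) (A : nalg B n).
Variables (Z : choiceType) (E : cellext A Z).
Variables (B' : algType K) (n' : nat) (A' : nalg B' n').
Variables (Z' : choiceType) (E' : cellext A' Z').
Variables (f0 : {lrmorphism B -> B'}) (f : {lrmorphism A -> A'}).
Hypothesis fs : forall a, nsrc0 A' (f a) = f0 (nsrc0 A a).
Hypothesis ft : forall a, ntgt0 A' (f a) = f0 (ntgt0 A a).
Hypothesis fi : forall b, f (nid0 A b) = nid0 A' (f0 b).

Definition lift_scal : {lrmorphism B -> extcell E'} := ext_id0 E' \o f0.
Definition lift_id : {linear A -> extcell E'} := extid E' \o f.

(** Exchange holds because the product of two cells of the target algebra can be
    expanded along sources or along targets, with the same result. *)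
Lemma ext_lift (g : Z -> extcell E') :
  (forall z, extsrc (g z) = f (cesrc E z)) ->
  (forall z, exttgt (g z) = f (cetgt E z)) ->
  {F : {lrmorphism extcell E -> extcell E'} |
    [/\ forall z, F (extgen E z) = g z,
        forall c, F (extid E c) = extid E' (f c),
        forall q, extsrc (F q) = f (extsrc q)
      & forall q, exttgt (F q) = f (exttgt q)]}.
Proof.
move=> gs gt; pose V := preeval lift_scal lift_id g.
have ul a c : lift_id (nid0 A a * c) = lift_scal a * lift_id c.
  by rewrite /= (rmorphM f) /= fi (rmorphM (extid E')).
have ur b c : lift_id (c * nid0 A b) = lift_id c * lift_scal b.
  by rewrite /= (rmorphM f) /= fi (rmorphM (extid E')).
have Vs x : extsrc (V x) = f (presrc E x).
  apply: (preext_ext (f := @extsrc _ _ _ _ _ E' \o V) (g := f \o presrc E)) => /=.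
    move=> a z b; rewrite preeval_sym presrc_sym !rmorphM /= !fi -gs.
    by rewrite !extsrc_id.
  by move=> c; rewrite preeval_id presrc_id /= extsrc_id.
have Vt x : exttgt (V x) = f (pretgt E x).
  apply: (preext_ext (f := @exttgt _ _ _ _ _ E' \o V) (g := f \o pretgt E)) => /=.
    move=> a z b; rewrite preeval_sym pretgt_sym !rmorphM /= !fi -gt.
    by rewrite !exttgt_id.
  by move=> c; rewrite preeval_id pretgt_id /= exttgt_id.
have VMr x y : V (premulr E x y) = V x * V y.
  rewrite [RHS]ext_mulr /= Vs Vt fs ft /V /premulr linearB linearD /=.
  rewrite preeval_lact // preeval_ract // preeval_id /= fi.
  by rewrite rmorphM.
have VMl x y : V (premull E x y) = V x * V y.
  rewrite [RHS]ext_mull /= Vs Vt fs ft /V /premull linearB linearD /=.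
  rewrite preeval_lact // preeval_ract // preeval_id /= fi.
  by rewrite rmorphM.
have VM x y : V (premulr E x y) = V (premull E x y) by rewrite VMr VMl.
have [F FE] := ext_eval ul ur VM.
have Fi c : F (extid E c) = extid E' (f c) by rewrite FE preeval_id.
have FM : monoid_morphism F.
  split=> [|p q]; first by rewrite -(rmorph1 (extid E)) Fi !rmorph1.
  rewrite -[p]extpiK -[q]extpiK extME extmulE !FE; exact: VMr.
pose FMi := GRing.isMonoidMorphism.Build (extcell E) (extcell E') F FM.
pose Fl := GRing.isLinear.Build K (extcell E) (extcell E') _ F (linearP F).
exists (HB.pack (F : extcell E -> extcell E') Fl FMi : {lrmorphism _ -> _}).
split=> //= [z|q|q].
- by rewrite FE preeval_sym !rmorph1 mul1r mulr1.
- by rewrite -[q]extpiK FE extsrcE Vs.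
- by rewrite -[q]extpiK FE exttgtE Vt.
Qed.
End ExtLift.

Section ExtLinear.
Variables (K : fieldType) (B : algType K) (n : nat) (A : nalg B n).
Variables (Z : choiceType) (E : cellext A Z).
Variables (Z2 : choiceType) (E2 : cellext (freeext E) Z2).

Lemma ext_src_tgt0 (m : extcell E2) : extsrc m = 0 ->
  nsrc0 (freeext E2) m = 0 /\ ntgt0 (freeext E2) m = 0.
Proof.
move=> m0; have [_ mt] := @prepar _ _ _ _ _ E2 (repr m).
split; first by rewrite /= m0 !raddf0.
by rewrite /= -[exttgt (exttgt m)]mt -/(extsrc m) m0 !raddf0.
Qed.

(** In dimension at least 2, a cell with null source also has null 0-target, so
    that its product with the identity of [c] is given by the action of either
    0-boundary of [c]. *)
Lemma mul_src_tgt0 (m : extcell E2) (c : extcell E) : extsrc m = 0 ->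
  m * ext_id0 E2 (ext_src0 E c) = m * ext_id0 E2 (ext_tgt0 E c)
  /\ ext_id0 E2 (ext_src0 E c) * m = ext_id0 E2 (ext_tgt0 E c) * m.
Proof.
move=> /ext_src_tgt0[ms mt].
have cs : nsrc0 (freeext E2) (extid E2 c) = ext_src0 E c by rewrite /= extsrc_id.
have ct : ntgt0 (freeext E2) (extid E2 c) = ext_tgt0 E c by rewrite /= exttgt_id.
rewrite -cs -ct; split.
  exact: etrans (esym (nmull_tgt0 (A := freeext E2) _ mt))
    (nmull_src0 (A := freeext E2) _ ms).
exact: etrans (esym (nmulr_tgt0 (A := freeext E2) _ mt))
  (nmulr_src0 (A := freeext E2) _ ms).
Qed.

Lemma preeval_src0 (g : Z -> extcell E2) x : (forall z, extsrc (g z) = 0) ->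
  extsrc (preeval (ext_id0 E2) (\0 : {linear A -> extcell E2}) g x) = 0.
Proof.
move=> gs; apply: (preext_ext
  (f := @extsrc _ _ _ _ _ E2 \o preeval (ext_id0 E2) \0 g) (g := \0)) => /=.
  by move=> a z b; rewrite preeval_sym !rmorphM /= gs mulr0 mul0r.
by move=> c; rewrite preeval_id raddf0.
Qed.

(** The exchange relation compares the actions of the 0-source and of the
    0-target of a cell on a value of [g]; these agree by [mul_src_tgt0]. *)
Lemma ext_linear_lift (g : Z -> extcell E2) :
  (forall z, extsrc (g z) = 0) ->
  {H : {linear extcell E -> extcell E2} |
    [/\ forall z, H (extgen E z) = g z,
        forall c, H (extid E c) = 0,
        forall q, extsrc (H q) = 0
      & forall a q b, H (ext_id0 E a * q * ext_id0 E b)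
          = ext_id0 E2 a * H q * ext_id0 E2 b]}.
Proof.
move=> gs.
pose V := preeval (ext_id0 E2) (\0 : {linear A -> extcell E2}) g.
have Vs x : extsrc (V x) = 0 by apply: preeval_src0.
have ul a c : \0 (nid0 A a * c) = ext_id0 E2 a * \0 c by rewrite mulr0.
have ur b c : \0 (c * nid0 A b) = \0 c * ext_id0 E2 b by rewrite mul0r.
have VMr x y : V (premulr E x y)
    = V x * ext_id0 E2 (presrc0 E y) + ext_id0 E2 (pretgt0 E x) * V y.
  rewrite /V /premulr linearB linearD /=.
  by rewrite preeval_lact // preeval_ract // preeval_id subr0.
have VMl x y : V (premull E x y)
    = ext_id0 E2 (presrc0 E x) * V y + V x * ext_id0 E2 (pretgt0 E y).
  rewrite /V /premull linearB linearD /=.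
  by rewrite preeval_lact // preeval_ract // preeval_id subr0.
have VM x y : V (premulr E x y) = V (premull E x y).
  rewrite VMr VMl addrC; congr (_ + _).
    have [_] := mul_src_tgt0 (extpi E x) (Vs y).
    by rewrite /= extsrcE exttgtE => ->.
  have [+ _] := mul_src_tgt0 (extpi E y) (Vs x).
  by rewrite /= extsrcE exttgtE => ->.
have [H HE] := ext_eval ul ur VM.
have Hi c : H (extid E c) = 0 by rewrite HE preeval_id.
have Hs a z b : H (ext_id0 E a * extgen E z * ext_id0 E b)
    = ext_id0 E2 a * g z * ext_id0 E2 b.
  by rewrite -ext_symE HE preeval_sym.
have Hg z : H (extgen E z) = g z.
  by rewrite HE preeval_sym !rmorph1 mul1r mulr1.
exists H; split=> // [q|a q b].
  by rewrite -[q]extpiK HE.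
apply: (ext_ext (f := H \o (ext_id0 E b \o* (ext_id0 E a \*o idfun)))
  (g := ext_id0 E2 b \o* (ext_id0 E2 a \*o H))) => [a' z b'|c] /=.
  by rewrite !mulrA -!rmorphM /= -!mulrA -!rmorphM /= !mulrA !Hs !rmorphM /= !mulrA.
by rewrite -!rmorphM /= !Hi mulr0 mul0r.
Qed.
End ExtLinear.

(** * Recursion along a collapsing scheme *)

(** The step is a functional on total functions, which lets it evaluate a whole
    linear combination of cells; locality makes the default value harmless. *)
Lemma wf_rec (T C : Type) (R : T -> T -> Prop) (dflt : C)
    (step : T -> (T -> C) -> C) :
  well_founded R ->
  (forall x g g', (forall y, R y x -> g y = g' y) -> step x g = step x g') ->
  {g : T -> C | forall x, g x = step x g}.
Proof.
move=> wfR loc.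
pose F x (r : forall y, R y x -> C) := step x (fun y =>
  match pselect (R y x) with left h => r y h | right _ => dflt end).
exists (Fix wfR (fun _ => C) F) => x; rewrite Fix_eq.
  by apply: loc => y Ryx; case: pselect.
by move=> {}x f f' e; apply: loc => y Ryx; case: pselect => // h; apply: e.
Qed.

Section CellRecursion.
Variables (K : fieldType) (X : polygraph K) (cell : cellmap X).
Variables (Y : forall n, pred (X n)) (phi : collapsing_scheme cell Y).

Definition cs_lt n (y x : X n) : Prop :=
  in_dom phi x /\ cell n (cs_rest phi x) y.

Lemma cs_lt_wf n : well_founded (@cs_lt n).
Proof.
have [_ _ _ wf] := cs_wf phi.
suff h p : Acc (fun y x => clos_refl_trans _ (collapse_gen cell phi (cs_rest phi)) x y
    /\ x <> y) p ->
  forall x, p = existT _ n x -> Acc (@cs_lt n) x by move=> x; apply: h (wf _) _ erefl.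
elim=> {}p _ IH x px; constructor => y [xd cy]; apply: IH erefl; rewrite px.
split; first by apply: rt_step; constructor=> //; right.
have [z xz] := xd; have [_ _ nx] := cs_boundary xz.
move=> e.
have xy : x = y := inj_pair2_eq_dec _ Nat.eq_dec _ _ _ _ e.
by case: nx; rewrite {2}xy.
Qed.

Lemma cell0P (a : freeoo X 0%N) w x :
  w \in msupp (a : freealg K (X 0%N)) -> x \in (w : seq (X 0%N)) -> cell 0%N a x.
Proof. by move=> wa xw; apply/(cellP cell a); exists w. Qed.

Lemma cell_decomp n (a : freeoo X n.+1) :
  exists (l : seq (K * ({fmonom (X 0%N)} * X n.+1 * {fmonom (X 0%N)})))
         (c : freeoo X n),
  (forall m, m \in l -> cell n.+1 a m.2.1.2) /\
  a = \sum_(m <- l) m.1 *: pmonomial m.2 + ooid (freeoo X) n c.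
Proof.
have [l [[_ [c ac]] _] lE] := cellP cell a.
exists l, c; split=> // m ml; apply/lE; exact: (map_f (fun d => d.2.1.2)).
Qed.

Lemma cell_linear_ext n (a : extcell (pext X n)) (W : lmodType K)
    (u v : {linear extcell (pext X n) -> W}) :
  (forall c, u (extid (pext X n) c) = v (extid (pext X n) c)) ->
  (forall b x b', cell n.+1 a x ->
     u (ext_id0 (pext X n) b * extgen (pext X n) x * ext_id0 (pext X n) b')
   = v (ext_id0 (pext X n) b * extgen (pext X n) x * ext_id0 (pext X n) b')) ->
  u a = v a.
Proof.
move=> ei eg; have [l [c [lc ->]]] := cell_decomp a.
rewrite 2!(linearD _) 2!(linear_sum _) /= ei; congr (_ + _).
rewrite !big_seq; apply: eq_bigr => m /lc ml.
by rewrite 2!(linearZ_LR _) /= [u _]eg.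
Qed.

(** In the middle of a recursion the values on cells are not known to define a
    map on A[Z], but they can be evaluated on a formal sum. This formal sum only
    involves the cells of cell(a), whatever the algebra of values. *)
Lemma cell_rep n (a : extcell (pext X n)) :
  {p : preext (ptrunc X n) (X n.+1) | extpi (pext X n) p = a /\
    forall (C : algType K) (i : {lrmorphism freealg K (X 0%N) -> C})
      (u : {linear ptrunc X n -> C}) (g g' : X n.+1 -> C),
    (forall x, cell n.+1 a x -> g x = g' x) ->
    preeval i u g p = preeval i u g' p}.
Proof.
apply: cid; have [l [c [lc ae]]] := cell_decomp a.
exists (\sum_(m <- l) m.1 *: sym (ptrunc X n) << m.2.1.1 >> m.2.1.2 << m.2.2 >>
  + preid _ c); split.
  rewrite [RHS]ae linearD linear_sum; congr (_ + _); apply: eq_bigr => m _.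
  by rewrite linearZ; congr (_ *: _); rewrite /= ext_symE.
move=> C i u g g' e; rewrite !linearD !linear_sum /= !preeval_id; congr (_ + _).
rewrite !big_seq; apply: eq_bigr => m /lc ml.
by rewrite !linearZ /= !preeval_sym e.
Qed.
End CellRecursion.

Section PreevalComp.
Variables (K : fieldType) (B : algType K) (n : nat) (A : nalg B n).
Variables (Z : choiceType) (C D : algType K).
Variables (i : {lrmorphism B -> C}) (u : {linear A -> C}) (g : Z -> C).
Variables (i' : {lrmorphism B -> D}) (u' : {linear A -> D}) (g' : Z -> D).

Lemma preeval_comp (w : {lrmorphism C -> D}) (p : preext A Z) :
  (forall b, w (i b) = i' b) -> (forall c, w (u c) = u' c) ->
  (forall z, w (g z) = g' z) -> w (preeval i u g p) = preeval i' u' g' p.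
Proof.
move=> ei eu eg.
apply: (preext_ext (f := w \o preeval i u g) (g := preeval i' u' g')) => /=.
  by move=> a z b; rewrite !preeval_sym !rmorphM /= !ei eg.
by move=> c; rewrite !preeval_id eu.
Qed.
End PreevalComp.

Section SchemeRecursion.
Variables (K : fieldType) (X : polygraph K) (cell : cellmap X).
Variables (Y : forall n, pred (X n)) (phi : collapsing_scheme cell Y).
Implicit Type n : nat.

Definition rest_rep n (x : X n.+1) : preext (ptrunc X n) (X n.+1) :=
  sval (cell_rep cell (cs_rest phi x)).

Lemma rest_repE n (x : X n.+1) : extpi (pext X n) (rest_rep x) = cs_rest phi x.
Proof. by have [] := svalP (cell_rep cell (cs_rest phi x)). Qed.

Lemma rest_rep_local n (x : X n.+1) (C : algType K)
    (i : {lrmorphism freealg K (X 0%N) -> C}) (u : {linear ptrunc X n -> C})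
    (g g' : X n.+1 -> C) :
  (forall y, cell n.+1 (cs_rest phi x) y -> g y = g' y) ->
  preeval i u g (rest_rep x) = preeval i u g' (rest_rep x).
Proof. by have [_ h] := svalP (cell_rep cell (cs_rest phi x)); apply: h. Qed.

(** Both [pi] and the homotopy are solutions of such an equation, with different
    values of [base] and [u]. *)
Lemma cs_recS n (C : algType K) (i : {lrmorphism freealg K (X 0%N) -> C})
    (u : {linear ptrunc X n -> C}) (base : X n.+1 -> C) :
  {g : X n.+1 -> C |
    (forall x, in_dom phi x ->
       g x = base x - (cs_coef phi x)^-1 *: preeval i u g (rest_rep x)) /\
    forall x, ~ in_dom phi x -> g x = base x}.
Proof.
pose step (x : X n.+1) (g : X n.+1 -> C) := base x -
  if pselect (in_dom phi x) then
    (cs_coef phi x)^-1 *: preeval i u g (rest_rep x) else 0.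
have [|g gE] := wf_rec (0 : C) (step := step) (@cs_lt_wf _ _ _ _ phi n.+1).
  move=> x g g' e; rewrite /step; case: pselect => // xd.
  by rewrite (@rest_rep_local _ _ _ _ _ g g') // => y cy; apply: e.
by exists g; split=> x xd; rewrite gE /step; case: pselect => h /=; rewrite ?subr0.
Qed.

Lemma cs_rec0 (C : algType K) (base : X 0%N -> C) :
  {g : X 0%N -> C |
    (forall x, in_dom phi x ->
       g x = base x - (cs_coef phi x)^-1 *: fa_lift g (cs_rest phi x)) /\
    forall x, ~ in_dom phi x -> g x = base x}.
Proof.
pose step (x : X 0%N) (g : X 0%N -> C) := base x -
  if pselect (in_dom phi x) then
    (cs_coef phi x)^-1 *: fa_lift g (cs_rest phi x) else 0.
have [|g gE] := wf_rec (0 : C) (step := step) (@cs_lt_wf _ _ _ _ phi 0%N).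
  move=> x g g' e; rewrite /step; case: pselect => // xd.
  rewrite (@fa_ext _ _ _ (fa_lift g) (fa_lift g')) // => w y wa yw.
  by rewrite /= !fa_lift_gen; apply: e; split=> //; apply: cell0P wa yw.
by exists g; split=> x xd; rewrite gE /step; case: pselect => h /=; rewrite ?subr0.
Qed.

Lemma coef_neq0 n (x : X n) : in_dom phi x -> cs_coef phi x != 0.
Proof. by move=> [z /cs_boundary[]]. Qed.

Lemma boundary_rest n (x : X n) (z : X n.+1) : phi n x = Some z ->
  cesrc (pext X n) z - cetgt (pext X n) z
  = cs_coef phi x *: (pgen x : ptrunc X n) + (cs_rest phi x : ptrunc X n).
Proof.
by move=> /cs_boundary[_ <- _]; rewrite /pboundary psrc_gen ptgt_gen.
Qed.

Lemma boundary_boundary n (z : X n.+2) :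
  psrc X n (cesrc (pext X n.+1) z - cetgt (pext X n.+1) z) = 0
  /\ ptgt X n (cesrc (pext X n.+1) z - cetgt (pext X n.+1) z) = 0.
Proof.
exact: extpar_sub (cepar (pext X n.+1) z).
Qed.

(** The next two lemmas say that x and x~ are parallel, cleared of denominators.
    They hold because the boundary of phi_x is a cycle. *)
Lemma rest_src n (x : X n.+1) : in_dom phi x ->
  extsrc (cs_rest phi x) = - (cs_coef phi x *: cesrc (pext X n) x).
Proof.
move=> [z xz]; have [+ _] := boundary_boundary z.
rewrite (boundary_rest xz) linearD linearZ /= extsrc_gen => /eqP.
by rewrite addrC addr_eq0 => /eqP.
Qed.

Lemma rest_tgt n (x : X n.+1) : in_dom phi x ->
  exttgt (cs_rest phi x) = - (cs_coef phi x *: cetgt (pext X n) x).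
Proof.
move=> [z xz]; have [_ +] := boundary_boundary z.
rewrite (boundary_rest xz) linearD linearZ /= exttgt_gen => /eqP.
by rewrite addrC addr_eq0 => /eqP.
Qed.
End SchemeRecursion.

(** * The induced polygraph *)

Section InducedPolygraph.
Variables (K : fieldType) (X : polygraph K) (cell : cellmap X).
Variables (Y : forall n, pred (X n)) (phi : collapsing_scheme cell Y).

Local Notation B := (freealg K (X 0%N)).
Local Notation B' := (freealg K (subcells Y 0%N)).

(** What must be known of [pi] in dimension n to construct it in dimension
    n + 1. The last condition makes the cells of the image of phi, which are to
    become identities, have equal images of source and target. *)
Record compatible (pi0 : {lrmorphism B -> B'}) n (A' : nalg B' n)
    (pi : {lrmorphism ptrunc X n -> A'}) : Prop := Compatible {
  comp_src : forall a, nsrc0 A' (pi a) = pi0 (nsrc0 (ptrunc X n) a);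
  comp_tgt : forall a, ntgt0 A' (pi a) = pi0 (ntgt0 (ptrunc X n) a);
  comp_id : forall b, pi (nid0 (ptrunc X n) b) = nid0 A' (pi0 b);
  comp_par : forall a b : ptrunc X n, npar a b -> npar (pi a) (pi b);
  comp_dom : forall x : X n, in_dom phi x -> pi (pgen x) = pi (cs_tilde phi x)
}.

Variable pi0 : {lrmorphism B -> B'}.

Section Stage.
Variables (n : nat) (A' : nalg B' n) (pi : {lrmorphism ptrunc X n -> A'}).
Hypothesis pic : compatible pi0 pi.

Definition image_ext : cellext A' (subcells Y n.+1) :=
  CellExt (fun y => comp_par pic (cepar (pext X n) (val y))).

Local Notation E' := image_ext.

Definition next_base (x : X n.+1) : extcell E' :=
  if phi n.+1 x is Some _ then 0 else
  if insub x is Some y then extgen E' y else extid E' (pi (cesrc (pext X n) x)).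

(** If x = phi_w, the difference of the two sides is the image of lambda w + a,
    and w has the same image as - a / lambda. *)
Lemma in_im_parallel (x : X n.+1) : in_im phi x ->
  pi (cesrc (pext X n) x) = pi (cetgt (pext X n) x).
Proof.
move=> [w wx]; have wd : in_dom phi w by exists x.
apply/subr0_eq; rewrite -(raddfB pi) /= (boundary_rest wx) (linearD pi) (linearZ_LR pi) /=.
rewrite (comp_dom pic wd) /cs_tilde (linearZ_LR pi) /= scalerA mulrN divff ?coef_neq0 //.
by rewrite scaleN1r addNr.
Qed.

Lemma next_stage : {F : {lrmorphism extcell (pext X n) -> extcell E'} |
  [/\ compatible pi0 (F : {lrmorphism ptrunc X n.+1 -> freeext E'}),
      [/\ forall a, pi (extsrc a) = extsrc (F a),
          forall a, pi (exttgt a) = exttgt (F a)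
        & forall c, F (extid (pext X n) c) = extid E' (pi c)],
      forall y : subcells Y n.+1, F (extgen (pext X n) (val y)) = extgen E' y
    & forall x : X n.+1, in_im phi x ->
        F (extgen (pext X n) x) = extid E' (pi (cesrc (pext X n) x))]}.
Proof.
have [g [gd gn]] := cs_recS phi (lift_scal E' pi0) (lift_id E' pi) next_base.
have domN (x : X n.+1) : ~ in_dom phi x -> phi n.+1 x = None.
  by case e: (phi n.+1 x) => [z|//] []; exists z.
have gY (y : subcells Y n.+1) : g (val y) = extgen E' y.
  have nd : ~ in_dom phi (val y).
    by have [_ _ h] := cs_disjoint phi (val y); move=> yd; apply: h; split; first exact: valP.
  by rewrite gn // /next_base domN // valK.
have gI (x : X n.+1) : in_im phi x -> g x = extid E' (pi (cesrc (pext X n) x)).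
  move=> xi; have [nY nd _] := cs_disjoint phi x.
  have xd : ~ in_dom phi x by move=> xd; apply: nd.
  rewrite gn // /next_base domN //; case: insubP => // y xY _.
  by case: nY.
(* Sources and targets of [g x] are computed inside A', by transporting the
   evaluation along the source and target maps: no morphism extending [g] is
   available before this equality is proved. *)
have gst x : extsrc (g x) = pi (cesrc (pext X n) x) /\
             exttgt (g x) = pi (cetgt (pext X n) x).
  elim/(well_founded_ind (@cs_lt_wf _ _ _ _ phi n.+1)): x => x IH.
  have [xi|xY|xd] := cs_cover phi x.
  - by rewrite gI // extsrc_id exttgt_id (in_im_parallel xi).
  - have -> : x = val (Sub x xY : subcells Y n.+1) by rewrite SubK.
    by rewrite gY extsrc_gen exttgt_gen.
  have b0 : next_base x = 0 by rewrite /next_base; case: xd => z ->.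
  have cN0 := coef_neq0 xd.
  rewrite gd // b0 sub0r !linearN !linearZ /=.
  rewrite (preeval_comp (w := @extsrc _ _ _ _ _ E')
    (i' := nid0 A' \o pi0) (u' := pi) (g' := @extsrc _ _ _ _ _ E' \o g)) //;
    try by move=> b /=; rewrite extsrc_id.
  rewrite (preeval_comp (w := @exttgt _ _ _ _ _ E')
    (i' := nid0 A' \o pi0) (u' := pi) (g' := @exttgt _ _ _ _ _ E' \o g)) //;
    try by move=> b /=; rewrite exttgt_id.
  rewrite (rest_rep_local _ _ (g := @extsrc _ _ _ _ _ E' \o g)
    (g' := pi \o cesrc (pext X n))); last first.
    by move=> y cy; have [] := IH y (conj xd cy).
  rewrite (rest_rep_local _ _ (g := @exttgt _ _ _ _ _ E' \o g)
    (g' := pi \o cetgt (pext X n))); last first.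
    by move=> y cy; have [] := IH y (conj xd cy).
  have -> : preeval (nid0 A' \o pi0) pi (pi \o cesrc (pext X n)) (rest_rep phi x)
      = pi (extsrc (cs_rest phi x)).
    rewrite -rest_repE extsrcE; apply: (preext_ext
      (g := pi \o presrc (pext X n))) => [a z b|c] /=.
      by rewrite preeval_sym presrc_sym !rmorphM /= !(comp_id pic).
    by rewrite preeval_id presrc_id.
  have -> : preeval (nid0 A' \o pi0) pi (pi \o cetgt (pext X n)) (rest_rep phi x)
      = pi (exttgt (cs_rest phi x)).
    rewrite -rest_repE exttgtE; apply: (preext_ext
      (g := pi \o pretgt (pext X n))) => [a z b|c] /=.
      by rewrite preeval_sym pretgt_sym !rmorphM /= !(comp_id pic).
    by rewrite preeval_id pretgt_id.
  rewrite rest_src // rest_tgt // !linearN !linearZ /= !scalerN !opprK !scalerA.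
  by rewrite mulVf // !scale1r.
have [F [Fg Fi Fs Ft]] := ext_lift (comp_src pic) (comp_tgt pic) (comp_id pic)
  (fun x => proj1 (gst x)) (fun x => proj2 (gst x)).
exists F; split=> //.
- split=> [a|a|b|a b [sab tab]|x xd] /=.
  + by rewrite Fs (comp_src pic).
  + by rewrite Ft (comp_tgt pic).
  + by rewrite Fi (comp_id pic).
  + by split; rewrite ?Fs ?Ft ?sab ?tab.
  rewrite Fg gd //.
  have -> : next_base x = 0 by rewrite /next_base; case: xd => z ->.
  rewrite sub0r /cs_tilde (linearZ_LR F) -scaleNr /=; congr (_ *: _).
  rewrite -rest_repE.
  apply: (preext_ext (g := F \o extpi (pext X n))) => [a z b|c] /=.
    by rewrite preeval_sym ext_symE !rmorphM /= Fg !Fi !(comp_id pic).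
  by rewrite preeval_id Fi.
- by split=> [a|a|c]; rewrite ?Fs ?Ft ?Fi.
- by move=> y; rewrite Fg gY.
- by move=> x xi; rewrite Fg gI.
Qed.
End Stage.

(** The extension in dimension n + 1 depends on [pi] up to dimension n, so the
    stage of [pi] is a parameter of the corecursion, although the result does
    not contain it. [induced_step] recovers it. *)
CoFixpoint induced_exts n (A' : nalg B' n) (pi : {lrmorphism ptrunc X n -> A'})
    (pic : compatible pi0 pi) : cellexts (subcells Y) A' :=
  let F := next_stage pic in
  CellExts (cehead := image_ext pic)
    (@induced_exts n.+1 (freeext (image_ext pic)) (sval F)
       (let: And4 h _ _ _ := svalP F in h)).

(** Taking [c] as a variable keeps the extensions of the polygraph under
    construction opaque: substituting it avoids any transport between the types
    of cells over equal n-algebras. *)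
Lemma induced_step n (A' : nalg B' n) (c : cellexts (subcells Y) A')
    (pi : {lrmorphism ptrunc X n -> A'}) (pic : compatible pi0 pi) :
  c = induced_exts pic ->
  {F : {lrmorphism ptrunc X n.+1 -> freeext (cehead c)} |
    [/\ exists h : compatible pi0 F, cetail c = induced_exts h,
      [/\ forall a, pi (extsrc a) = extsrc (F a),
          forall a, pi (exttgt a) = exttgt (F a)
        & forall a, F (extid (pext X n) a) = extid (cehead c) (pi a)],
      [/\ forall y, cesrc (cehead c) y = pi (cesrc (pext X n) (val y)),
          forall y, cetgt (cehead c) y = pi (cetgt (pext X n) (val y))
        & forall y, F (extgen (pext X n) (val y)) = extgen (cehead c) y]
    & forall x : X n.+1, in_im phi x ->
        F (extgen (pext X n) x) = extid (cehead c) (pi (cesrc (pext X n) x))]}.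
Proof.
move=> ->; exists (sval (next_stage pic)).
have [Fc Fb FY FI] := svalP (next_stage pic).
split=> //.
by exists (let: And4 h _ _ _ := svalP (next_stage pic) in h).
Qed.
End InducedPolygraph.

Section InducedExists.
Variables (K : fieldType) (X : polygraph K) (cell : cellmap X).
Variables (Y : forall n, pred (X n)) (phi : collapsing_scheme cell Y).
Local Notation B := (freealg K (X 0%N)).
Local Notation B' := (freealg K (subcells Y 0%N)).

Lemma first_stage : { f : {lrmorphism B -> B'} |
  @compatible _ _ _ _ phi f 0%N (nalg0 B') f /\
  forall y : subcells Y 0%N, f << fmu (val y) >> = << fmu y >>}.
Proof.
pose base (x : X 0%N) : B' := if insub x is Some y then << fmu y >> else 0.
have [g [gd gn]] := cs_rec0 phi base.
exists (fa_lift g); split=> [|y]; last first.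
  rewrite /= fa_lift_gen gn ?/base ?valK // => yd.
  by have [_ _] := cs_disjoint phi (val y); apply; split; first exact: valP.
split; [by []|by []|by []|by []|move=> x xd].
apply: etrans (fa_lift_gen g x) _.
apply: etrans _ (esym (linearZ_LR (fa_lift g) _ (cs_rest phi x))).
rewrite gd //=.
have -> : base x = 0.
  rewrite /base; case: insubP => // y xY _.
  by have [_ _] := cs_disjoint phi x; case.
by rewrite sub0r scaleNr.
Qed.

Theorem induced_exists : exists (T : pstruct K (subcells Y))
  (pi : oomorphism (freeoo X) (freeoo (Polygraph T))), induced phi pi.
Proof.
have [pi0 [pic piY]] := first_stage.
pose T : pstruct K (subcells Y) := induced_exts pic.
pose P := Polygraph T.
pose stage n := { f : {lrmorphism ptrunc X n -> ptrunc P n} |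
  exists h : compatible phi pi0 f, projT2 (pstage P n) = induced_exts h}.
have st0 : {s : stage 0%N | forall y : subcells Y 0%N,
    sval s (pgen (val y)) = pgen (y : P 0%N)}.
  pose pi : {lrmorphism ptrunc X 0%N -> ptrunc P 0%N} := pi0.
  have h : exists h : compatible phi pi0 pi, projT2 (pstage P 0) = induced_exts h.
    by exists pic.
  by exists (exist _ pi h).
have stS n (s : stage n) : {s' : stage n.+1 |
  let pi := sval s in let F := sval s' in
  [/\ [/\ forall a, pi (psrc X n a) = psrc P n (F a),
          forall a, pi (ptgt X n a) = ptgt P n (F a)
        & forall a, F (pid X n a) = pid P n (pi a)],
      [/\ forall y, cesrc (pext P n) y = pi (cesrc (pext X n) (val y)),
          forall y, cetgt (pext P n) y = pi (cetgt (pext X n) (val y))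
        & forall y : subcells Y n.+1, F (pgen (val y)) = pgen (y : P n.+1)]
    & forall x : X n.+1, in_im phi x ->
        F (pgen x) = pid P n (pi (cesrc (pext X n) x))]}.
  case: s => pi e; have [h e'] := cid e.
  have [F [Fh Fb FY FI]] := induced_step e'.
  by exists (exist _ F Fh).
pose fix st n : stage n := if n is m.+1 then sval (stS m (st m)) else sval st0.
pose PI := @OOMorphism K (freeoo X) (freeoo P) (fun n => sval (st n))
  (fun n => let: And3 (And3 h _ _) _ _ := svalP (stS n (st n)) in h)
  (fun n => let: And3 (And3 _ h _) _ _ := svalP (stS n (st n)) in h)
  (fun n => let: And3 (And3 _ _ h) _ _ := svalP (stS n (st n)) in h).
exists T, PI; split.
- exact: (fun n => let: And3 _ (And3 h _ _) _ := svalP (stS n (st n)) in h).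
- exact: (fun n => let: And3 _ (And3 _ h _) _ := svalP (stS n (st n)) in h).
- case=> [|n]; first exact: (svalP st0).
  exact: (let: And3 _ (And3 _ _ h) _ := svalP (stS n (st n)) in h).
- by move=> n x xd; have [h _] := svalP (st n); apply: (comp_dom h).
- exact: (fun n => let: And3 _ _ h := svalP (stS n (st n)) in h).
Qed.
End InducedExists.

(** * Contraction of A(X) onto A(Y) *)

Section ProductExpansion.
Variables (K : fieldType) (B : algType K) (n : nat) (A : nalg B n).
Local Notation i0 := (nid0 A).
Local Notation s0 := (nsrc0 A).
Local Notation t0 := (ntgt0 A).

(** The middle factor is split as (q - m) + m, where the first term has null
    0-target and the second null 0-source, so that only 0-sources of p and r
    act on the first and only 0-targets on the second. *)
Lemma nmul_split (p q r m : A) (a a' b b' : B) :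
  s0 p = a -> t0 p = a' -> s0 r = b -> t0 r = b' ->
  s0 m = 0 -> t0 q = t0 m ->
  p * q * r = i0 a * (q - m) * i0 b + i0 a' * m * i0 b'.
Proof.
move=> <- <- <- <- sm tqm.
have tq : t0 (q - m) = 0 by rewrite linearB /= tqm subrr.
rewrite -{1}[q](subrK m) mulrDr mulrDl.
rewrite (nmulr_tgt0 p tq) (nmulr_src0 p sm).
have tq' : t0 (i0 (s0 p) * (q - m)) = 0 by rewrite rmorphM /= tq mulr0.
have sm' : s0 (i0 (t0 p) * m) = 0 by rewrite rmorphM /= sm mulr0.
by rewrite (nmull_tgt0 r tq') (nmull_src0 r sm').
Qed.
End ProductExpansion.

Lemma linear_link (K : fieldType) (U V : lmodType K) (w : {linear U -> V})
    (k : K) (a b c d e : U) :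
  w (a - k *: (b - c - d) - k *: e) = w a - k *: (w b - w c - w d) - k *: w e.
Proof. by rewrite !(linearB w) !(linearZ_LR w) !(linearB w). Qed.

Lemma link_tgt_eq (K : fieldType) (V : lmodType K) (k : K) (x s t a r : V) :
  k != 0 -> s - t = k *: x + a ->
  x - k^-1 *: (s - t - a) - k^-1 *: r = - (k^-1 *: r).
Proof. by move=> k0 ->; rewrite addrK scalerA mulVf // scale1r subrr sub0r. Qed.

Lemma link_proj_eq (K : fieldType) (V : lmodType K) (k : K) (x s f a r : V) :
  f = s -> r = a -> x - k *: (s - f - a) - k *: r = x.
Proof. by move=> -> ->; rewrite subrr sub0r scalerN opprK addrK. Qed.

Lemma linearNZ (K : fieldType) (U V : lmodType K) (w : {linear U -> V}) k u :
  w (- (k *: u)) = - (k *: w u).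
Proof. by rewrite (linearN w) (linearZ_LR w). Qed.

Lemma scale_link (K : fieldType) (V : lmodType K) (k : K) (u a b e : V) :
  k != 0 -> u = a - k^-1 *: b - k^-1 *: e -> k *: u = k *: a - b - e.
Proof. by move=> k0 ->; rewrite !scalerBr !scalerA divff // !scale1r. Qed.

Section Lifting.
Variables (K : fieldType) (X : polygraph K) (cell : cellmap X).
Variables (Y : forall n, pred (X n)) (phi : collapsing_scheme cell Y).
Variables (T : pstruct K (subcells Y)).
Local Notation P := (Polygraph T).
Variable pi : oomorphism (freeoo X) (freeoo P).
Hypothesis pi_ind : induced phi pi.

Local Notation B := (freealg K (X 0%N)).
Local Notation B' := (freealg K (subcells Y 0%N)).

(** [pi], with its source and target seen as the algebras of the successive
    extensions. *)
Definition proj n : {lrmorphism ptrunc X n -> ptrunc P n} := pi n.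

Lemma proj_src n (a : extcell (pext X n)) :
  proj n (extsrc a) = extsrc (proj n.+1 a : extcell (pext P n)).
Proof. exact: (oomap_src pi a). Qed.
Lemma proj_tgt n (a : extcell (pext X n)) :
  proj n (exttgt a) = exttgt (proj n.+1 a : extcell (pext P n)).
Proof. exact: (oomap_tgt pi a). Qed.
Lemma proj_id n c :
  proj n.+1 (extid (pext X n) c) = extid (pext P n) (proj n c).
Proof. exact: (oomap_id pi c). Qed.

Lemma proj_id0 n b : proj n (nid0 (ptrunc X n) b) = nid0 (ptrunc P n) (proj 0%N b).
Proof.
elim: n => [//|n IHn].
by rewrite -[LHS]/(proj n.+1 (extid (pext X n) _)) proj_id IHn.
Qed.

Lemma proj_gen0 (y : subcells Y 0%N) : proj 0%N << fmu (val y) >> = << fmu y >>.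
Proof. exact: (ind_crit pi_ind y). Qed.
Lemma proj_gen n (y : subcells Y n.+1) :
  proj n.+1 (extgen (pext X n) (val y)) = extgen (pext P n) y.
Proof. exact: (ind_crit pi_ind y). Qed.
Lemma proj_cesrc n (y : subcells Y n.+1) :
  cesrc (pext P n) y = proj n (cesrc (pext X n) (val y)).
Proof. exact: (ind_src pi_ind y). Qed.
Lemma proj_cetgt n (y : subcells Y n.+1) :
  cetgt (pext P n) y = proj n (cetgt (pext X n) (val y)).
Proof. exact: (ind_tgt pi_ind y). Qed.

Lemma proj_dom n (x : X n) : in_dom phi x ->
  proj n (pgen x) = - ((cs_coef phi x)^-1 *: proj n (cs_rest phi x)).
Proof.
move=> xd; apply: etrans (ind_dom pi_ind xd) _.
by apply: etrans (linearZ_LR (proj n) _ _) _; rewrite /= scaleNr.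
Qed.

Lemma proj_im n (x : X n) (z : X n.+1) : phi n x = Some z ->
  proj n.+1 (extgen (pext X n) z) = extid (pext P n) (proj n (cesrc (pext X n) z)).
Proof.
by move=> xz; apply: (ind_im pi_ind (x := z)); exists x.
Qed.

Definition sec0 : {lrmorphism B' -> B} :=
  fa_lift (fun y : subcells Y 0%N => << fmu (val y) >> : B).

Definition retr0 : {lrmorphism B -> B} := sec0 \o proj 0%N.

(** The section [iota] and the homotopy [h] in a single dimension n.

    [ct_htgt] is the homotopy identity on cycles; general cells are handled
    inside the step from n to n + 1. [ct_phi] is the equation
    lambda h(x) + h(a) = phi_x - 1_{s(phi_x)}.

    In [ct_mul], m is a cell 0 -> iota pi c. For n = 0, [h] is a derivation
    relative to the identity and iota pi, and m accounts for the difference with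
    a morphism of bimodules. For n > 0, the two terms containing m cancel.
    [ct_link] provides the 1-cells a -> iota pi a, seen in dimension n + 1, that
    are responsible for this cancellation. *)
Record contraction n (iota : {lrmorphism ptrunc P n -> ptrunc X n})
    (h : {linear ptrunc X n -> extcell (pext X n)}) : Prop := Contraction {
  ct_src0 : forall a, nsrc0 (ptrunc X n) (iota a) = sec0 (nsrc0 (ptrunc P n) a);
  ct_tgt0 : forall a, ntgt0 (ptrunc X n) (iota a) = sec0 (ntgt0 (ptrunc P n) a);
  ct_id0 : forall b, iota (nid0 (ptrunc P n) b) = nid0 (ptrunc X n) (sec0 b);
  ct_par : forall a b : ptrunc P n, npar a b -> npar (iota a) (iota b);
  ct_proj : forall a, proj n (iota a) = a;
  ct_hsrc : forall c, extsrc (h c) = 0;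
  ct_hproj : forall c, proj n.+1 (h c) = 0;
  ct_htgt : forall c : ptrunc X n, npar c 0 ->
    exttgt (h c) = iota (proj n c) - c;
  ct_phi : forall (x : X n) z, phi n x = Some z ->
    h (cesrc (pext X n) z - cetgt (pext X n) z)
    = extgen (pext X n) z - extid (pext X n) (cesrc (pext X n) z);
  ct_mul : forall a b c (m : extcell (pext X n)),
    extsrc m = 0 -> exttgt m = iota (proj n c) ->
    h (nid0 (ptrunc X n) a * c * nid0 (ptrunc X n) b)
    = ext_id0 (pext X n) a * h c * ext_id0 (pext X n) b
      + ext_id0 (pext X n) (retr0 a) * m * ext_id0 (pext X n) (retr0 b)
      - ext_id0 (pext X n) a * m * ext_id0 (pext X n) b;
  ct_link : forall a, exists c : extcell (pext X n),
    ext_src0 (pext X n) c = a /\ ext_tgt0 (pext X n) c = retr0 a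
}.

Lemma not_dom n (x : X n) : Y x -> ~ in_dom phi x.
Proof. by move=> xY xd; have [_ _] := cs_disjoint phi x; apply. Qed.

Lemma sec0_gen (y : subcells Y 0%N) : sec0 << fmu y >> = << fmu (val y) >>.
Proof. exact: fa_lift_gen. Qed.

Lemma proj_sec0 b : proj 0%N (sec0 b) = b.
Proof.
apply: (fa_ext (f1 := proj 0%N \o sec0) (f2 := idfun)) => w y _ _.
by rewrite /= sec0_gen proj_gen0.
Qed.

Definition link_base (x : X 0%N) : extcell (pext X 0%N) :=
  extid (pext X 0%N) << fmu x >> -
  if phi 0%N x is Some z then
    (cs_coef phi x)^-1 *: (extid (pext X 0%N) (cesrc (pext X 0%N) z)
       - extgen (pext X 0%N) z - extid (pext X 0%N) (cs_rest phi x))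
  else 0.

(** In dimension 0 the homotopy is the difference between the morphism [eta] and
    the identity cells. Being a morphism, [eta] is determined by its values on
    letters: the identity for letters of Y, and a solution of
    lambda (eta(x) - 1_x) + (eta(a) - 1_a) = phi_x - 1_{s(phi_x)} otherwise. *)
Lemma link_exists : { eta : {lrmorphism B -> extcell (pext X 0%N)} |
  [/\ forall a, extsrc (eta a) = a, forall a, exttgt (eta a) = retr0 a,
      forall a, proj 1%N (eta a) = extid (pext P 0%N) (proj 0%N a)
    & forall x z, phi 0%N x = Some z ->
      cs_coef phi x *: eta << fmu x >> =
      cs_coef phi x *: extid (pext X 0%N) << fmu x >>
      - (extid (pext X 0%N) (cesrc (pext X 0%N) z)
       - extgen (pext X 0%N) z - extid (pext X 0%N) (cs_rest phi x))
      - eta (cs_rest phi x)]}.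
Proof.
have [g [gd gn]] := cs_rec0 phi link_base.
pose eta : {lrmorphism B -> extcell (pext X 0%N)} := fa_lift g.
have etag x : eta << fmu x >> = g x by apply: fa_lift_gen.
have etaz x z : phi 0%N x = Some z -> eta << fmu x >> =
  extid (pext X 0%N) << fmu x >>
  - (cs_coef phi x)^-1 *: (extid (pext X 0%N) (cesrc (pext X 0%N) z)
       - extgen (pext X 0%N) z - extid (pext X 0%N) (cs_rest phi x))
  - (cs_coef phi x)^-1 *: eta (cs_rest phi x).
  by move=> xz; rewrite etag gd ?/link_base ?xz //; exists z.
have etaY x : Y x -> eta << fmu x >> = extid (pext X 0%N) << fmu x >>.
  move=> /not_dom xd; rewrite etag gn // /link_base.
  by case e: (phi 0%N x) => [z|]; [case: xd; exists z|rewrite subr0].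
(* A letter is in Y or in the domain of phi, and in the latter case the rest
   of the boundary only involves smaller letters. *)
have ind (C : algType K) (u v : {lrmorphism B -> C}) :
    (forall x, Y x -> u << fmu x >> = v << fmu x >>) ->
    (forall x z, phi 0%N x = Some z -> u (cs_rest phi x) = v (cs_rest phi x) ->
       u << fmu x >> = v << fmu x >>) -> forall a, u a = v a.
  move=> uvY uvd a; apply: fa_ext => _ x _ _.
  elim/(well_founded_ind (@cs_lt_wf _ _ _ _ phi 0%N)): x => x IH.
  have [[]|/uvY //|[z xz]] := cs_cover phi x; apply: (uvd x z xz).
  apply: fa_ext => w y wa yw; apply: IH; split; first by exists z.
  exact: cell0P wa yw.
have bd x z : phi 0%N x = Some z -> cs_coef phi x != 0 /\
    cesrc (pext X 0%N) z - cetgt (pext X 0%N) z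
    = cs_coef phi x *: (<< fmu x >> : B) + (cs_rest phi x : B).
  by move=> xz; split; [apply: coef_neq0; exists z|apply: (boundary_rest xz)].
exists eta; split.
- apply: (ind _ (@extsrc _ _ _ _ _ (pext X 0%N) \o eta) idfun) => [x xY|x z xz e] /=.
    by rewrite etaY // extsrc_id.
  rewrite (etaz _ _ xz); apply: etrans (linear_link (@extsrc _ _ _ _ _ (pext X 0%N)) _ _ _ _ _ _) _.
  rewrite /= !extsrc_id extsrc_gen.
  have -> : extsrc (eta (cs_rest phi x)) = cs_rest phi x := e.
  by rewrite subrr sub0r scalerN opprK addrK.
- apply: (ind _ (@exttgt _ _ _ _ _ (pext X 0%N) \o eta) retr0) => [x xY|x z xz e] /=.
    rewrite etaY // exttgt_id.
    have -> : x = val (Sub x xY : subcells Y 0%N) by rewrite SubK.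
    by rewrite proj_gen0 sec0_gen.
  have [c0 xb] := bd _ _ xz.
  rewrite (etaz _ _ xz); apply: etrans (linear_link (@exttgt _ _ _ _ _ (pext X 0%N)) _ _ _ _ _ _) _.
  rewrite /= !exttgt_id exttgt_gen.
  have -> : exttgt (eta (cs_rest phi x)) = retr0 (cs_rest phi x) := e.
  apply: etrans (link_tgt_eq _ c0 xb) _.
  have -> : proj 0%N << fmu x >> = - ((cs_coef phi x)^-1 *: proj 0%N (cs_rest phi x)).
    by apply: (proj_dom (x := x)); exists z.
  exact: esym (linearNZ sec0 _ _).
- apply: (ind _ (proj 1%N \o eta) (extid (pext P 0%N) \o proj 0%N)) => [x xY|x z xz e] /=.
    by rewrite etaY // proj_id.
  rewrite (etaz _ _ xz); apply: etrans (linear_link (proj 1%N) _ _ _ _ _ _) _.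
  apply: etrans (link_proj_eq _ _ _ _) (proj_id _).
    exact: etrans (proj_im xz) (esym (proj_id _)).
  exact: etrans e (esym (proj_id _)).
move=> x z xz; have [c0 _] := bd _ _ xz.
exact: scale_link c0 (etaz _ _ xz).
Qed.
End Lifting.

Lemma link_phi_eq (K : fieldType) (U V : lmodType K) (h u v : {linear U -> V})
    (k : K) (d x a : U) (s f : V) :
  (forall c, h c = u c - v c) -> d = k *: x + a ->
  k *: u x = k *: v x - (s - f - v a) - u a -> h d = f - s.
Proof.
move=> he -> e; rewrite he (linearD u) (linearD v) (linearZ_LR u) (linearZ_LR v) e.
rewrite addrNK !opprB opprD !addrA [LHS](ACl (1*5*2*6*3*4))%AC /=.
by rewrite subrr add0r subrr add0r.
Qed.

Lemma nmul_split_sub (A : pzRingType) (a b f c m g h : A) :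
  a * (h - m) * b + f * m * g - a * c * b
  = a * (h - c) * b + f * m * g - a * m * b.
Proof. by rewrite !mulrBr !mulrBl [RHS](ACl (1*4*3*2))%AC. Qed.

Section BaseCase.
Variables (K : fieldType) (X : polygraph K) (cell : cellmap X).
Variables (Y : forall n, pred (X n)) (phi : collapsing_scheme cell Y).
Variables (T : pstruct K (subcells Y)).
Local Notation P := (Polygraph T).
Variable pi : oomorphism (freeoo X) (freeoo P).
Hypothesis pi_ind : induced phi pi.
Local Notation B := (freealg K (X 0%N)).
Local Notation B' := (freealg K (subcells Y 0%N)).

Lemma contraction0 : exists iota h, @contraction K X cell Y phi T pi 0%N iota h.
Proof.
have [eta [es et ep ez]] := link_exists pi_ind.
pose h : {linear ptrunc X 0%N -> extcell (pext X 0%N)} := eta \- extid (pext X 0%N).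
have hE c : h c = eta c - extid (pext X 0%N) c by [].
exists (sec0 Y : {lrmorphism ptrunc P 0%N -> ptrunc X 0%N}), h; split.
- by [].
- by [].
- by [].
- by [].
- exact: (proj_sec0 pi_ind).
- by move=> c; rewrite hE linearB /= es extsrc_id subrr.
- move=> c; rewrite hE; apply: etrans (linearB (proj pi 1%N) _ _) _.
  apply/eqP; rewrite subr_eq0; apply/eqP.
  exact: etrans (ep c) (esym (proj_id pi c)).
- by move=> c _; rewrite hE linearB /= et exttgt_id.
- move=> x z xz; have xd : in_dom phi x by exists z.
  exact: link_phi_eq hE (boundary_rest xz) (ez x z xz).
- move=> a b c m ms mt.
  rewrite -nmul_split_sub hE.
  have e := nmul_split (A := freeext (pext X 0%N)) (p := eta a) (q := eta c)
    (r := eta b) (es a) (et a) (es b) (et b) ms (etrans (et c) (esym mt)).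
  apply: etrans (congr2 (fun u v : extcell (pext X 0%N) => u - v) (etrans _ e)
    (y2 := ext_id0 (pext X 0%N) a * extid (pext X 0%N) c * ext_id0 (pext X 0%N) b)
    _) _.
  - by apply: etrans (rmorphM eta _ _) _; rewrite (rmorphM eta).
  - apply: etrans (rmorphM (extid (pext X 0%N)) _ _) _.
    by rewrite (rmorphM (extid (pext X 0%N))).
  - by [].
- by move=> a; exists (eta a); split; [apply: es|apply: et].
Qed.
End BaseCase.

Lemma htpy_linear_eq (K : fieldType) (V : lmodType K) (k : K)
    (x y sx sy hx hy : V) :
  k *: x + y - (k *: sx + sy) - (k *: hx + hy)
  = k *: (x - sx - hx) + (y - sy - hy).
Proof. by rewrite !scalerBr !opprD !addrA [LHS](ACl (1*3*5*2*4*6))%AC. Qed.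

Lemma htpy_mul_eq (A : pzRingType) (a b fa fb Fx x sf sx hd : A) :
  a * (Fx - x - (sf - sx) - hd) * b
  = fa * Fx * fb - a * x * b - (fa * sf * fb - a * sx * b)
    - (a * hd * b + fa * (Fx - sf) * fb - a * (Fx - sf) * b).
Proof.
rewrite !(mulrBr, mulrBl) !(opprB, opprD, addrA).
rewrite [RHS](ACl (5*2*3*6*7*(1*9)*(4*8)))%AC.
by rewrite /= subrr addNr !addr0.
Qed.

Lemma htpy_crit_eq (V : zmodType) (sf x sx hd : V) :
  0 = sf + (x - sx) + hd - x - (sf - sx) - hd.
Proof.
rewrite opprB !addrA [RHS](ACl ((1*7)*(2*5)*(3*6)*(4*8)))%AC /=.
by rewrite !(subrr, addNr, addr0).
Qed.

Lemma htpy_im_eq (V : zmodType) (sf x sx : V) :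
  0 = sf - x - (sf - sx) - - (x - sx).
Proof.
rewrite opprK opprB !addrA [RHS](ACl ((1*4)*(2*5)*(3*6)))%AC /=.
by rewrite !(subrr, addNr, addr0).
Qed.

Lemma ext_morph_ext (K : fieldType) (B : algType K) (n : nat) (A : nalg B n)
    (Z : choiceType) (E : cellext A Z) (C : algType K)
    (f g : {lrmorphism extcell E -> C}) :
  (forall z, f (extgen E z) = g (extgen E z)) ->
  (forall c, f (extid E c) = g (extid E c)) -> f =1 g.
Proof.
move=> eg ei; apply: ext_ext => [a z b|//].
by rewrite !rmorphM /= eg !ei.
Qed.

Section Homotopy.
Variables (K : fieldType) (B : algType K) (n : nat) (A : nalg B n).
Variables (Z : choiceType) (E : cellext A Z).
Variables (Z2 : choiceType) (E2 : cellext (freeext E) Z2).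
Variables (f0 : {lrmorphism B -> B}) (f : {lrmorphism A -> A}).
Variables (F : {lrmorphism extcell E -> extcell E}).
Hypothesis Fs : forall c, extsrc (F c) = f (extsrc c).
Hypothesis Ft : forall c, exttgt (F c) = f (exttgt c).
Hypothesis Fi : forall c, F (extid E c) = extid E (f c).
Hypothesis fi : forall b, f (nid0 A b) = nid0 A (f0 b).
Variable h : {linear A -> extcell E}.
Hypothesis h_mul : forall a b c (m : extcell E), extsrc m = 0 -> exttgt m = f c ->
  h (nid0 A a * c * nid0 A b) = ext_id0 E a * h c * ext_id0 E b
    + ext_id0 E (f0 a) * m * ext_id0 E (f0 b) - ext_id0 E a * m * ext_id0 E b.
Variable H : {linear extcell E -> extcell E2}.
Hypothesis Hi : forall c, H (extid E c) = 0.
Hypothesis HM : forall a q b, H (ext_id0 E a * q * ext_id0 E b)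
  = ext_id0 E2 a * H q * ext_id0 E2 b.

(** The target of H(c) dictated by the homotopy identity: F - id - h d, minus its
    identity part. Here [F] stands for iota pi in dimension n + 1. *)
Definition htpy (c : extcell E) : extcell E :=
  F c - c - extid E (extsrc (F c - c)) - h (exttgt c - extsrc c).

Fact htpy_linear : linear htpy.
Proof.
move=> k x y; rewrite /htpy.
have -> : F (k *: x + y) - (k *: x + y) = k *: (F x - x) + (F y - y).
  by rewrite linearP scalerBr opprD addrACA.
have -> : exttgt (k *: x + y) - extsrc (k *: x + y)
    = k *: (exttgt x - extsrc x) + (exttgt y - extsrc y).
  rewrite (linearP (@exttgt _ _ _ _ _ E)) (linearP (@extsrc _ _ _ _ _ E)).
  by rewrite /= scalerBr opprD addrACA.
rewrite (linearP (@extsrc _ _ _ _ _ E)) (linearP (extid E)) (linearP h).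
exact: htpy_linear_eq.
Qed.
HB.instance Definition _ :=
  GRing.isLinear.Build K (extcell E) (extcell E) _ htpy htpy_linear.

Lemma htpy_id c : exttgt (H (extid E c)) = htpy (extid E c).
Proof.
rewrite Hi linear0 /htpy Fi -(linearB (extid E)) /= extsrc_id extsrc_id exttgt_id.
by rewrite !subrr linear0 subr0.
Qed.

(** With m = F(x) - 1_{s(F(x))}, the correction terms in [h_mul] are exactly the
    difference between f0(a) m f0(b), which comes from F(axb), and the term a m b
    of the target of a H(x) b. *)
Lemma htpy_mul a x b : exttgt (H x) = htpy x ->
  exttgt (H (ext_id0 E a * x * ext_id0 E b))
  = htpy (ext_id0 E a * x * ext_id0 E b).
Proof.
move=> e; rewrite HM !(rmorphM (@exttgt _ _ _ _ _ E2)) /= !exttgt_id e.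
have sD y : extid E (extsrc (F y - y))
    = extid E (f (extsrc y)) - extid E (extsrc y).
  by rewrite linearB /= Fs linearB.
pose m := F x - extid E (f (extsrc x)).
have ms : extsrc m = 0 by rewrite linearB /= Fs extsrc_id subrr.
have mt : exttgt m = f (exttgt x - extsrc x).
  by rewrite linearB /= Ft exttgt_id raddfB.
have es : extsrc (ext_id0 E a * x * ext_id0 E b)
    = nid0 A a * extsrc x * nid0 A b by rewrite !rmorphM /= !extsrc_id.
have et : exttgt (ext_id0 E a * x * ext_id0 E b)
    = nid0 A a * exttgt x * nid0 A b by rewrite !rmorphM /= !exttgt_id.
have eF : F (ext_id0 E a * x * ext_id0 E b)
    = ext_id0 E (f0 a) * F x * ext_id0 E (f0 b).
  by rewrite !rmorphM /= !Fi !fi.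
have ef : extid E (f (nid0 A a * extsrc x * nid0 A b))
    = ext_id0 E (f0 a) * extid E (f (extsrc x)) * ext_id0 E (f0 b).
  by rewrite !(rmorphM f) /= !fi !(rmorphM (extid E)).
have ei : extid E (nid0 A a * extsrc x * nid0 A b)
    = ext_id0 E a * extid E (extsrc x) * ext_id0 E b.
  by rewrite !(rmorphM (extid E)).
have ed : exttgt (ext_id0 E a * x * ext_id0 E b)
    - extsrc (ext_id0 E a * x * ext_id0 E b)
    = nid0 A a * (exttgt x - extsrc x) * nid0 A b.
  by rewrite es et (mulrBr (nid0 A a)) (mulrBl (nid0 A b)).
rewrite /htpy ed (sD x) (sD (_ * _)) es ef ei eF (h_mul _ _ ms mt).
exact: htpy_mul_eq.
Qed.

Lemma htpy_crit x : H x = 0 ->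
  F x = extid E (f (extsrc x)) + (x - extid E (extsrc x))
    + h (exttgt x - extsrc x) ->
  exttgt (H x) = htpy x.
Proof.
move=> -> Fx; rewrite linear0 /htpy linearB /= Fs linearB /= Fx.
exact: htpy_crit_eq.
Qed.

Lemma htpy_im x : H x = 0 -> F x = extid E (f (extsrc x)) ->
  h (extsrc x - exttgt x) = x - extid E (extsrc x) ->
  exttgt (H x) = htpy x.
Proof.
move=> -> Fx hx; rewrite linear0 /htpy linearB /= Fs linearB /= Fx.
rewrite -[exttgt x - extsrc x]opprB (linearN h) hx; exact: htpy_im_eq.
Qed.

Lemma htpy_cycle c : extsrc c = 0 -> exttgt c = 0 -> htpy c = F c - c.
Proof.
move=> cs ct; rewrite /htpy (linearB (@extsrc _ _ _ _ _ E)) /= Fs cs ct.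
by rewrite !(raddf0 f) !subrr (raddf0 (extid E)) (raddf0 h) !subr0.
Qed.

(** The cell lambda x + a is a cycle killed by F, hence its image by [htpy] is its
    opposite, which is also the target of [p] - 1_{s(p)}; by linearity the
    identity on [a] gives the identity on [x]. *)
Lemma htpy_dom x (k : K) a (p : extcell E2) : k != 0 ->
  extsrc p - exttgt p = k *: x + a -> F x = - (k^-1 *: F a) ->
  H x = k^-1 *: (p - extid E2 (extsrc p)) - k^-1 *: H a ->
  exttgt (H a) = htpy a -> exttgt (H x) = htpy x.
Proof.
move=> k0 d Fx Hx e.
have ps : extsrc (extsrc p) = extsrc (exttgt p) := proj1 (prepar E2 (repr p)).
have pt : exttgt (extsrc p) = exttgt (exttgt p) := proj2 (prepar E2 (repr p)).
have ds : extsrc (k *: x + a) = 0.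
  by rewrite -d (linearB (@extsrc _ _ _ _ _ E)) /= ps subrr.
have dt : exttgt (k *: x + a) = 0.
  by rewrite -d (linearB (@exttgt _ _ _ _ _ E)) /= pt subrr.
have Fd : F (k *: x + a) = 0.
  by rewrite (linearP F) /= Fx scalerN scalerA divff // scale1r addNr.
have d0 : htpy (k *: x + a) = - (k *: x + a) by rewrite htpy_cycle // Fd sub0r.
have -> : htpy x = k^-1 *: (htpy (k *: x + a) - htpy a).
  by rewrite (linearP htpy) /= addrK scalerA mulVf // scale1r.
rewrite d0 Hx (linearB (@exttgt _ _ _ _ _ E2)) !(linearZ_LR (@exttgt _ _ _ _ _ E2)) /=.
rewrite (linearB (@exttgt _ _ _ _ _ E2)) /= exttgt_id e -d.
by rewrite [RHS]scalerBr opprB.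
Qed.
End Homotopy.

Section HomotopyRecursion.
Variables (K : fieldType) (X : polygraph K) (cell : cellmap X).
Variables (Y : forall n, pred (X n)) (phi : collapsing_scheme cell Y).
Variable n : nat.
Local Notation E := (pext X n).
Local Notation E2 := (pext X n.+1).

(** The part of H(x) known in advance in
    H(x) = (phi_x - 1_{s(phi_x)}) / lambda - H(a) / lambda. *)
Definition htpy_base (x : X n.+1) : extcell E2 :=
  if phi n.+1 x is Some z then
    (cs_coef phi x)^-1 *: (extgen E2 z - extid E2 (cesrc E2 z))
  else 0.

Lemma htpy_base_src x : extsrc (htpy_base x) = 0.
Proof.
rewrite /htpy_base; case: (phi n.+1 x) => [z|]; last exact: raddf0.
apply: (linear_Zsub0 (w := @extsrc _ _ _ _ _ E2)).
by rewrite /= extsrc_gen extsrc_id.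
Qed.

Lemma htpy_exists : { H : {linear extcell E -> extcell E2} |
  [/\ forall x, in_dom phi x -> H (extgen E x)
        = htpy_base x - (cs_coef phi x)^-1 *: H (cs_rest phi x),
      forall x, ~ in_dom phi x -> H (extgen E x) = 0,
      forall c, H (extid E c) = 0,
      forall q, extsrc (H q) = 0
    & forall a q b, H (ext_id0 E a * q * ext_id0 E b)
        = ext_id0 E2 a * H q * ext_id0 E2 b]}.
Proof.
have [g [gd gn]] := cs_recS phi (ext_id0 E2)
  (\0 : {linear ptrunc X n -> extcell E2}) htpy_base.
have base0 x : ~ in_dom phi x -> htpy_base x = 0.
  by rewrite /htpy_base; case e: (phi n.+1 x) => [z|//] []; exists z.
have gs x : extsrc (g x) = 0.
  elim/(well_founded_ind (@cs_lt_wf _ _ _ _ phi n.+1)): x => x IH.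
  have [xd|xd] := pselect (in_dom phi x); last by rewrite gn // htpy_base_src.
  rewrite gd //; apply: (linear_subZ0 (w := @extsrc _ _ _ _ _ E2));
    first exact: htpy_base_src.
  pose g' y := if pselect (cell n.+1 (cs_rest phi x) y) then g y else 0.
  rewrite (rest_rep_local _ _ (g' := g')).
    apply: preeval_src0 => y; rewrite /g'; case: pselect => cy /=.
      exact: (IH y (conj xd cy)).
    exact: (linear0 (@extsrc _ _ _ _ _ E2)).
  by move=> y cy; rewrite /g'; case: pselect.
have [H [Hg Hi Hs HM]] := @ext_linear_lift K _ n (ptrunc X n) _ E _ E2 g gs.
exists H; split; [move=> x xd|move=> x xd|exact: Hi|exact: Hs|exact: HM];
  last by rewrite Hg gn // base0.
have HR : preeval (ext_id0 E2) \0 g (rest_rep phi x) = H (cs_rest phi x); last first.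
  exact: etrans (Hg x) (etrans (gd x xd)
    (congr1 (fun v => htpy_base x - (cs_coef phi x)^-1 *: v) HR)).
rewrite -rest_repE; apply: esym.
apply: (preext_ext (f := H \o extpi E)) => [a z b|c] /=.
  by rewrite preeval_sym ext_symE HM Hg.
by rewrite preeval_id Hi.
Qed.
End HomotopyRecursion.

Lemma section_tgt_eq (V : zmodType) (a b d : V) : a + d + (b - a - d) = b.
Proof. by rewrite -(addrA b) -opprD [LHS]addrC subrK. Qed.

Section SectionStep.
Variables (K : fieldType) (X : polygraph K) (cell : cellmap X).
Variables (Y : forall n, pred (X n)) (phi : collapsing_scheme cell Y).
Variables (T : pstruct K (subcells Y)).
Local Notation P := (Polygraph T).
Variable pi : oomorphism (freeoo X) (freeoo P).
Hypothesis pi_ind : induced phi pi.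
Variables (n : nat) (iota : {lrmorphism ptrunc P n -> ptrunc X n}).
Variable h : {linear ptrunc X n -> extcell (pext X n)}.
Hypothesis ct : contraction phi pi iota h.
Local Notation E := (pext X n).
Local Notation E' := (pext P n).

Lemma par_cycle (x : X n.+1) : npar (cetgt E x - cesrc E x) 0.
Proof.
have := npar_lin (-1) (cepar E x) (npar_refl (cetgt E x)).
by rewrite !scaleN1r addNr addrC.
Qed.

(** The term h(t(y) - s(y)) corrects the boundary of y: on the cycle t(y) - s(y)
    the homotopy goes from 0 to its image by iota pi minus itself. *)
Lemma section_exists : { F : {lrmorphism extcell E' -> extcell E} |
  [/\ forall y : subcells Y n.+1, F (extgen E' y)
        = extid E (iota (proj pi n (cesrc E (val y))))
          + (extgen E (val y) - extid E (cesrc E (val y)))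
          + h (cetgt E (val y) - cesrc E (val y)),
      forall c, F (extid E' c) = extid E (iota c),
      forall q, extsrc (F q) = iota (extsrc q)
    & forall q, exttgt (F q) = iota (exttgt q)]}.
Proof.
apply: (ext_lift (ct_src0 ct) (ct_tgt0 ct) (ct_id0 ct)) => y.
  rewrite !(linearD (@extsrc _ _ _ _ _ E)) (linearN (@extsrc _ _ _ _ _ E)) /=.
  rewrite !extsrc_id extsrc_gen (ct_hsrc ct) subrr !addr0.
  by rewrite (proj_cesrc pi_ind).
rewrite !(linearD (@exttgt _ _ _ _ _ E)) (linearN (@exttgt _ _ _ _ _ E)) /=.
rewrite !exttgt_id exttgt_gen (ct_htgt ct (par_cycle _)) (proj_cetgt pi_ind).
rewrite (raddfB (proj pi n)) (raddfB iota) /=; exact: section_tgt_eq.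
Qed.
End SectionStep.

Lemma boundary_eq0 (K : fieldType) (B : algType K) (n : nat) (A : nalg B n)
    (Z : choiceType) (E : cellext A Z) (c : extcell E) :
  extpar c 0 -> extsrc c = 0 /\ exttgt c = 0.
Proof.
by move=> [-> ->]; split; [exact: linear0 (@extsrc _ _ _ _ _ E)
  |exact: linear0 (@exttgt _ _ _ _ _ E)].
Qed.

(** The actions of [a] and [a'] on [m] agree, as they are the two 0-boundaries of a
    same cell. *)
Lemma link_cancel (K : fieldType) (B : algType K) (n : nat) (A : nalg B n)
    (Z : choiceType) (E : cellext A Z)
    (Z2 : choiceType) (E2 : cellext (freeext E) Z2)
    (a a' b b' : B) (p q : extcell E) (m c : extcell E2) :
  ext_src0 E p = a -> ext_tgt0 E p = a' ->
  ext_src0 E q = b -> ext_tgt0 E q = b' -> extsrc m = 0 ->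
  ext_id0 E2 a * c * ext_id0 E2 b = ext_id0 E2 a * c * ext_id0 E2 b
    + ext_id0 E2 a' * m * ext_id0 E2 b' - ext_id0 E2 a * m * ext_id0 E2 b.
Proof.
move=> <- <- <- <- m0; have [_ <-] := mul_src_tgt0 p m0.
by rewrite -!mulrA; have [<- _] := mul_src_tgt0 q m0; rewrite addrK.
Qed.

Lemma section_gen_proj (V W : zmodType) (w : {additive V -> W})
    (s g c h : V) (r : W) :
  w s = w c -> w g = r -> w h = 0 -> w (s + (g - c) + h) = r.
Proof. by move=> sc gr h0; rewrite !raddfD raddfN /= sc gr h0 addr0 addrC subrK. Qed.

Section Step.
Variables (K : fieldType) (X : polygraph K) (cell : cellmap X).
Variables (Y : forall n, pred (X n)) (phi : collapsing_scheme cell Y).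
Variables (T : pstruct K (subcells Y)).
Local Notation P := (Polygraph T).
Variable pi : oomorphism (freeoo X) (freeoo P).
Hypothesis pi_ind : induced phi pi.
Variables (n : nat) (iota : {lrmorphism ptrunc P n -> ptrunc X n}).
Variable h : {linear ptrunc X n -> extcell (pext X n)}.
Hypothesis ct : contraction phi pi iota h.
Local Notation E := (pext X n).
Local Notation E2 := (pext X n.+1).
Local Notation E' := (pext P n).

Variable F : {lrmorphism extcell E' -> extcell E}.
Hypothesis Fg : forall y : subcells Y n.+1, F (extgen E' y)
  = extid E (iota (proj pi n (cesrc E (val y))))
    + (extgen E (val y) - extid E (cesrc E (val y)))
    + h (cetgt E (val y) - cesrc E (val y)).
Hypothesis Fi : forall c, F (extid E' c) = extid E (iota c).
Hypothesis Fs : forall q, extsrc (F q) = iota (extsrc q).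
Hypothesis Ft : forall q, exttgt (F q) = iota (exttgt q).

Variable H : {linear extcell E -> extcell E2}.
Hypothesis Hd : forall x, in_dom phi x -> H (extgen E x)
  = htpy_base phi x - (cs_coef phi x)^-1 *: H (cs_rest phi x).
Hypothesis Hn : forall x, ~ in_dom phi x -> H (extgen E x) = 0.
Hypothesis Hi : forall c, H (extid E c) = 0.
Hypothesis Hs : forall q, extsrc (H q) = 0.
Hypothesis HM : forall a q b, H (ext_id0 E a * q * ext_id0 E b)
  = ext_id0 E2 a * H q * ext_id0 E2 b.

Let projE : {lrmorphism extcell E -> extcell E'} := proj pi n.+1.
Let FP : {lrmorphism extcell E -> extcell E} := F \o projE.
Let f : {lrmorphism ptrunc X n -> ptrunc X n} := iota \o proj pi n.

Lemma step_proj (a : extcell E') : projE (F a) = a.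
Proof.
apply: (ext_morph_ext (f := projE \o F) (g := idfun)) => [y|c].
  rewrite /= Fg; apply: section_gen_proj; last exact: (ct_hproj ct).
    by rewrite /projE /= !proj_id (ct_proj ct).
  exact: (proj_gen pi_ind).
by rewrite /= Fi; apply: etrans (proj_id pi _) _; rewrite (ct_proj ct).
Qed.

Lemma FP_src c : extsrc (FP c) = f (extsrc c).
Proof. by rewrite /= Fs /projE -proj_src. Qed.
Lemma FP_tgt c : exttgt (FP c) = f (exttgt c).
Proof. by rewrite /= Ft /projE -proj_tgt. Qed.
Lemma FP_id c : FP (extid E c) = extid E (f c).
Proof. by rewrite /= -Fi; congr (F _); exact: proj_id. Qed.
Lemma f_id0 b : f (nid0 (ptrunc X n) b) = nid0 (ptrunc X n) (retr0 pi b).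
Proof. by rewrite /= proj_id0 (ct_id0 ct). Qed.

(** On generators by recursion: critical cells by definition of [F], cells of the
    image of phi by [ct_phi], cells of the domain from the smaller cells of the
    rest of the boundary. *)
Lemma step_htpy c : exttgt (H c) = htpy FP h c.
Proof.
have hid := htpy_id FP_id h Hi.
have hmul a x b := @htpy_mul _ _ _ _ _ _ _ _ _ _ _ FP_src FP_tgt FP_id f_id0
  _ (ct_mul ct) _ HM a x b.
have hgen x : exttgt (H (extgen E x)) = htpy FP h (extgen E x).
  elim/(well_founded_ind (@cs_lt_wf _ _ _ _ phi n.+1)): x => x IH.
  have [[w wx]|xY|xd] := cs_cover phi x.
  - have xn : ~ in_dom phi x.
      by move=> xd; have [_ + _] := cs_disjoint phi x; apply; split=> //; exists w.
    apply: (htpy_im FP_src); first exact: Hn.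
      by rewrite extsrc_gen -FP_id; congr (F _); rewrite /projE proj_id; exact: (proj_im pi_ind wx).
    by rewrite extsrc_gen exttgt_gen; exact: (ct_phi ct wx).
  - apply: (htpy_crit FP_src); first by apply: Hn; exact: not_dom xY.
    rewrite extsrc_gen exttgt_gen; have := Fg (Sub x xY); rewrite SubK => <-.
    congr (F _); have := proj_gen pi_ind (Sub x xY : subcells Y n.+1).
    by rewrite SubK.
  have [z xz] := xd.
  apply: (htpy_dom FP_src (k := cs_coef phi x) (a := cs_rest phi x)
    (p := extgen E2 z)).
  - exact: coef_neq0.
  - rewrite extsrc_gen exttgt_gen; exact: boundary_rest xz.
  - rewrite /=; have -> : projE (extgen E x)
      = - ((cs_coef phi x)^-1 *: projE (cs_rest phi x)) by exact: (proj_dom pi_ind xd).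
    exact: linearNZ.
  - by rewrite Hd // /htpy_base xz extsrc_gen.
  apply: (cell_linear_ext (cell := cell) (u := @exttgt _ _ _ _ _ E2 \o H) (v := htpy FP h));
    [exact: hid|move=> b y b' cy].
  exact: (hmul _ _ _ (IH y (conj xd cy))).
apply: (ext_ext (f := @exttgt _ _ _ _ _ E2 \o H) (g := htpy FP h)); [move=> a z b|exact: hid].
by apply: hmul; apply: hgen.
Qed.

(** Under [pi], phi_x becomes the identity of its source, so the recursion defining
    H has zero as projected solution. *)
Lemma step_hproj c : proj pi n.+2 (H c : ptrunc X n.+2) = 0.
Proof.
pose projE2 : {lrmorphism extcell E2 -> extcell (pext P n.+1)} := proj pi n.+2.
rewrite -[LHS]/(projE2 (H c)).
have hid d : projE2 (H (extid E d)) = 0 by rewrite Hi raddf0.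
have hmul a x b : projE2 (H x) = 0 ->
    projE2 (H (ext_id0 E a * x * ext_id0 E b)) = 0.
  by move=> e; rewrite HM !(rmorphM projE2) /= e mulr0 mul0r.
have base0 x : projE2 (htpy_base phi x) = 0.
  rewrite /htpy_base; case xz: (phi n.+1 x) => [z|]; last exact: raddf0.
  apply: (linear_Zsub0 (w := projE2)).
  exact: etrans (proj_im pi_ind xz) (esym (proj_id pi _)).
have hgen x : projE2 (H (extgen E x)) = 0.
  elim/(well_founded_ind (@cs_lt_wf _ _ _ _ phi n.+1)): x => x IH.
  have [xd|xd] := pselect (in_dom phi x); last by rewrite Hn // raddf0.
  rewrite Hd //; apply: (linear_subZ0 (w := projE2)); first exact: base0.
  apply: (cell_linear_ext (cell := cell) (u := projE2 \o H) (v := \0));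
    [exact: hid|move=> b y b' cy].
  exact: (hmul _ _ _ (IH y (conj xd cy))).
apply: (ext_ext (f := projE2 \o H) (g := \0)); [move=> a z b|exact: hid].
by apply: hmul; apply: hgen.
Qed.

Lemma step_contraction : contraction (n := n.+1) phi pi F H.
Proof.
split.
- by move=> a; apply: etrans (congr1 _ (Fs a)) (ct_src0 ct _).
- by move=> a; apply: etrans (congr1 _ (Ft a)) (ct_tgt0 ct _).
- by move=> b; apply: etrans (Fi _) (congr1 _ (ct_id0 ct b)).
- by move=> a b [sab tab]; split; [rewrite !Fs sab|rewrite !Ft tab].
- exact: step_proj.
- exact: Hs.
- exact: step_hproj.
- move=> c /boundary_eq0[cs ct0].
  by apply: etrans (step_htpy c) _; apply: (htpy_cycle FP_src).
- move=> x z xz; have xd : in_dom phi x by exists z.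
  rewrite (boundary_rest xz).
  apply: etrans (linearP H _ _ _) _; rewrite /= [H (pgen x)](Hd xd).
  have c0 := coef_neq0 xd.
  rewrite scalerBr scalerA divff // scale1r addrNK /htpy_base xz.
  by rewrite scalerA divff // scale1r.
- move=> a b c m ms _; have [p [ps pt]] := ct_link ct a.
  have [q [qs qt]] := ct_link ct b.
  by apply: etrans (HM _ _ _) _; apply: link_cancel ps pt qs qt ms.
- move=> a; have [p [ps pt]] := ct_link ct a.
  by exists (extid E2 p); rewrite /= extsrc_id exttgt_id.
Qed.
End Step.

(** * Presented algebras and acyclicity *)

Section IdealMaps.
Variables (K : fieldType) (R : algType K) (G : R -> Prop).
Variables (R' : algType K) (G' : R' -> Prop).

Lemma ideal_genN x : ideal_gen G x -> ideal_gen G (- x).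
Proof. by move=> ix; rewrite -sub0r; apply: ideal_genB => //; exact: ideal_gen0. Qed.

Lemma ideal_genD x y : ideal_gen G x -> ideal_gen G y -> ideal_gen G (x + y).
Proof. by move=> ix /ideal_genN iy; rewrite -[y]opprK; apply: ideal_genB. Qed.

Lemma ideal_gen_congr x y : ideal_gen G (x - y) -> ideal_gen G y -> ideal_gen G x.
Proof. by move=> ixy /(ideal_genD ixy); rewrite subrK. Qed.

Lemma ideal_genZ k x : ideal_gen G x -> ideal_gen G (k *: x).
Proof. by move=> ix; rewrite -[x]mul1r scalerAl; apply: ideal_genMl. Qed.

Lemma ideal_gen_map (f : {lrmorphism R -> R'}) :
  (forall x, G x -> ideal_gen G' (f x)) ->
  forall x, ideal_gen G x -> ideal_gen G' (f x).
Proof.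
move=> fG x; elim=> {x} [x|||a x _ ix|x a _ ix]; first exact: fG.
- by rewrite raddf0; apply: ideal_gen0.
- by move=> x y _ ix _ iy; rewrite raddfB; apply: ideal_genB.
- by rewrite rmorphM; apply: ideal_genMl.
- by rewrite rmorphM; apply: ideal_genMr.
Qed.

Lemma quot_map (f : {lrmorphism R -> R'}) :
  (forall x, G x -> ideal_gen G' (f x)) ->
  exists2 F : {rmorphism quot_alg G -> quot_alg G'},
    (forall x, F (ideal_pi G x) = ideal_pi G' (f x))
    & forall k, F (ascal (quot_alg G) k) = ascal (quot_alg G') k.
Proof.
move=> fG; pose F (q : quot_alg G) : quot_alg G' := ideal_pi G' (f (repr q)).
have FE x : F (ideal_pi G x) = ideal_pi G' (f x).
  apply/ideal_piP; rewrite -(raddfB f); apply: (ideal_gen_map fG).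
  by apply/ideal_piP; rewrite ideal_piK.
have FB : zmod_morphism F.
  move=> p q; rewrite -[p]ideal_piK -[q]ideal_piK.
  rewrite -(raddfB (ideal_pi G)) !FE (raddfB f).
  exact: (raddfB (ideal_pi G')).
have FM : monoid_morphism F.
  split=> [|p q]; first by rewrite -[1]/(ideal_pi G 1) FE rmorph1.
  rewrite -[p]ideal_piK -[q]ideal_piK -[_ * _]ideal_piM !FE (rmorphM f).
  exact: ideal_piM.
pose F1 := GRing.isZmodMorphism.Build (quot_alg G) (quot_alg G') F FB.
pose F2 := GRing.isMonoidMorphism.Build (quot_alg G) (quot_alg G') F FM.
exists (HB.pack F F1 F2 : {rmorphism quot_alg G -> quot_alg G'}); first exact: FE.
move=> k; apply: etrans (FE _) _; congr (ideal_pi G' _).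
by rewrite (linearZ_LR f) /= rmorph1.
Qed.
End IdealMaps.

(** Only the symbols a z b contribute to the boundary, and they contribute
    a (s(z) - t(z)) b. *)
Lemma ideal_ext_boundary (K : fieldType) (B : algType K) (n : nat) (A : nalg B n)
    (Z : choiceType) (E : cellext A Z) (G : A -> Prop) (c : extcell E) :
  (forall z, G (cesrc E z - cetgt E z)) -> ideal_gen G (extsrc c - exttgt c).
Proof.
move=> GZ; rewrite /extsrc /exttgt /presrc /pretgt /flin.
rewrite opprD addrACA subrr addr0 -sumrB.
apply: big_ind => [||[[a x] b] _]; [exact: ideal_gen0|exact: ideal_genD|].
rewrite -scalerBr; apply: ideal_genZ; rewrite /= -mulrBl -mulrBr.
exact/ideal_genMr/ideal_genMl/ideal_gen_in.
Qed.

Lemma ideal_boundary (K : fieldType) (Q : polygraph K)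
    (c : extcell (pext Q 0%N)) :
  ideal_gen (R := freeoo Q 0%N) (fun r => exists x : Q 1%N, r = pcsrc x - pctgt x)
    ((extsrc c : freeoo Q 0%N) - (exttgt c : freeoo Q 0%N)).
Proof.
by apply: (ideal_ext_boundary (A := ptrunc Q 0%N)) => x; exists x.
Qed.

Section Conclusion.
Variables (K : fieldType) (X : polygraph K) (cell : cellmap X).
Variables (Y : forall n, pred (X n)) (phi : collapsing_scheme cell Y).
Variables (T : pstruct K (subcells Y)).
Local Notation P := (Polygraph T).
Variable pi : oomorphism (freeoo X) (freeoo P).
Hypothesis pi_ind : induced phi pi.

Lemma contraction_exists n : exists iota h, contraction (n := n) phi pi iota h.
Proof.
elim: n => [|n [iota [h ct]]]; first exact: contraction0.
have [F [Fg Fi Fs Ft]] := section_exists pi_ind ct.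
have [H [Hd Hn Hi Hs HM]] := htpy_exists phi n.
by exists F, H; apply: (step_contraction pi_ind ct).
Qed.

Lemma collapse_acyclic n : (0 < n)%N -> acyclic (pext X n) -> acyclic (pext P n).
Proof.
move=> n0 acX a b ab; have [iota [h ct]] := contraction_exists n.
have [c [cs ct']] := acX _ _ (ct_par ct ab).
exists (proj pi n.+1 c); rewrite -[extsrc _]proj_src -[exttgt _]proj_tgt cs ct'.
by split; apply: (ct_proj ct).
Qed.

(** The isomorphism is induced by the inclusion of letters. The relation of a cell
    y of Y is pi(s(y) - t(y)), whose inclusion is congruent to s(y) - t(y) by the
    1-cells of [ct_link]. *)
Lemma collapse_presented : exists2 F : {rmorphism presented P -> presented X},
  bijective F & forall k, F (ascal (presented P) k) = ascal (presented X) k.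
Proof.
have [iota [h ct]] := contraction_exists 0%N.
pose GX (r : freeoo X 0%N) := exists x : X 1%N, r = pcsrc x - pctgt x.
pose GP (r : freeoo P 0%N) := exists y : P 1%N, r = pcsrc y - pctgt y.
pose p0 : {lrmorphism freeoo X 0%N -> freeoo P 0%N} := proj pi 0%N.
pose s0 : {lrmorphism freeoo P 0%N -> freeoo X 0%N} := sec0 Y.
have retr a : ideal_gen GX (s0 (p0 a) - a).
  have [c [<- ca]] := ct_link ct a.
  rewrite -opprB; apply: ideal_genN.
  have := ideal_boundary c; congr (ideal_gen _ (_ - _)); exact: ca.
have p0G x : GX x -> ideal_gen GP (p0 x).
  move=> [z ->]; rewrite raddfB.
  have := ideal_boundary (proj pi 1%N (extgen (pext X 0%N) z)).
  by rewrite -proj_src -proj_tgt extsrc_gen exttgt_gen.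
have s0G x : GP x -> ideal_gen GX (s0 x).
  move=> [y ->].
  have -> : pcsrc y - pctgt y = p0 (pcsrc (val y) - pctgt (val y)).
    apply: etrans _ (esym (raddfB p0 _ _)).
    by congr (_ - _); [exact: (proj_cesrc pi_ind)|exact: (proj_cetgt pi_ind)].
  apply: ideal_gen_congr (retr _) _.
  by apply: ideal_gen_in; exists (val y).
have [F FE Fk] := quot_map s0G; have [F' F'E _] := quot_map p0G.
exists F => //; exists F' => q; rewrite -[q]ideal_piK.
  rewrite [F _]FE [LHS]F'E; congr (ideal_pi _ _); exact: (proj_sec0 pi_ind).
by rewrite [F' _]F'E [LHS]FE; apply/ideal_piP.
Qed.
End Conclusion.

Theorem theorem5p3p4 (K : fieldType) (A : algebra K) (X : polygraph K)
    (Y : forall n : nat, pred (X n)) (cell : cellmap X)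
    (phi : collapsing_scheme cell Y) :
  is_resolution X A ->
  (exists (T : pstruct K (subcells Y))
          (pi : oomorphism (freeoo X) (freeoo (Polygraph T))),
     induced phi pi) /\
  (forall (T : pstruct K (subcells Y))
          (pi : oomorphism (freeoo X) (freeoo (Polygraph T))),
     induced phi pi -> is_resolution (Polygraph T) A).
Proof.
move=> [[f fbij fscal] acX]; split=> [|T pi pi_ind]; first exact: induced_exists.
split=> [|n n0]; last exact: (collapse_acyclic pi_ind n0 (acX n n0)).
have [F Fbij Fscal] := collapse_presented pi_ind.
exists (f \o F); first exact: bij_comp fbij Fbij.
by move=> k; rewrite /= Fscal fscal.
Qed.
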